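(* Let $(s_1e^{i\theta_1},t_1)$ and $(s_2e^{i\theta_2},t_2)$ be non-trivial elements of the Heisenberg group $\mathbb{C}\times\mathbb{R}$, with $s_1,s_2\ge 0$ and $t_1,t_2\in\mathbb{R}$; that is, $(s_j,t_j)\ne(0,0)$ for $j=1,2$. (The angle $\theta_j$ is only defined when $s_j\neq 0$.) Let $$A=\begin{pmatrix} 1 & -\sqrt{2}s_1e^{-i\theta_1} & -s_1^2+it_1 \\ 0 & 1 & \sqrt{2}s_1e^{i\theta_1} \\ 0 & 0 & 1 \end{pmatrix},\qquad B=\begin{pmatrix} 1 & 0 & 0 \\ \sqrt{2}s_2e^{i\theta_2} & 1 & 0 \\ -s_2^2+it_2 & -\sqrt{2}s_2e^{-i\theta_2} & 1 \end{pmatrix}$$ be the associated Heisenberg translations in $\mathrm{SU}(2,1)$, fixing $\infty$ and $o$ respectively. If $s_1,s_2\ne 0$, suppose (replacing one of $A$, $B$ by its inverse if necessary) that $-\pi/2\le \theta_1-\theta_2\le \pi/2$. If at least one of the following four conditions is satisfied, then the group $\langle A,B\rangle$ is discrete and freely generated by $A$ and $B$. (1) $$|s_1^2+it_1|^{1/2}|s_2^2+it_2|^{1/2} \ge 2^{1/2}\left(\left(1-\tfrac{t_2}{|s_2^2+it_2|}\right)^{1/3}+\left(1+\tfrac{t_2}{|s_2^2+it_2|}\right)^{1/3}\right)^{3/4}\left(\left(1-\tfrac{t_1}{|s_1^2+it_1|}\right)^{1/3}+\left(1+\tfrac{t_1}{|s_1^2+it_1|}\right)^{1/3}\right)^{3/4}.$$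 (2) $s_1\neq 0$ and $$s_1\,|s_2^2+it_2|^{1/2}\ge \begin{cases}\dfrac{2s_2^3}{|s_2^2+it_2|^{3/2}}\cos(\theta_1-\theta_2)+2 & \text{if } s_2\neq 0,\\[2mm] 2 & \text{if } s_2=0.\end{cases}$$ (3) $s_2\neq 0$ and $$|s_1^2+it_1|^{1/2}\,s_2\ge \begin{cases}\dfrac{2s_1^3}{|s_1^2+it_1|^{3/2}}\cos(\theta_1-\theta_2)+2 & \text{if } s_1\neq 0,\\[2mm] 2 & \text{if } s_1=0.\end{cases}$$ (4) $s_1\ne0$, $s_2\neq 0$ and $s_1s_2\ge 4\cos^3\bigl((\theta_1-\theta_2)/3\bigr)$.
   Context: $\mathrm{SU}(2,1)$ is the special unitary group of the Hermitian form $\langle \mathbf{z},\mathbf{w}\rangle=\bar w_3z_1+\bar w_2z_2+\bar w_1z_3$ of signature $(2,1)$ on $\mathbb{C}^3$. It acts on complex hyperbolic space $\mathbf{H}^2_{\mathbb{C}}$ (projectivised negative vectors) and on its boundary $\partial\mathbf{H}^2_{\mathbb{C}}$ (projectivised non-zero null vectors). The point $\infty$ is the class of $(1,0,0)^t$ and $o$ is the class of $(0,0,1)^t$. The Heisenberg group is $\mathbb{C}\times\mathbb{R}$ with group law $(\zeta_1,v_1)\cdot(\zeta_2,v_2)=(\zeta_1+\zeta_2,\,v_1+v_2+2\Im(\zeta_1\bar\zeta_2))$. When $s_j=0$ the product $s_je^{\pm i\theta_j}$ is understood to be $0$. ''Freely generated by $A$ and $B$'' means that $\langle A,B\rangle$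 is a free group of rank two with free basis $\{A,B\}$. *)

(* Defs.v *)
From HB Require Import structures.
From mathcomp Require Import all_boot all_order all_algebra complex.
From mathcomp Require Import all_classical all_reals all_analysis.
From mathcomp Require Import ring.

Set Implicit Arguments.
Unset Strict Implicit.
Unset Printing Implicit Defensive.

Import Order.TTheory GRing.Theory Num.Theory numFieldNormedType.Exports.

Local Open Scope classical_set_scope.
Local Open Scope ring_scope.
Local Open Scope complex_scope.

Definition mx3 (K : nzRingType) (rows : seq (seq K)) : 'M[K]_3 :=
  \matrix_(i < 3, j < 3) nth 0 (nth [::] rows i) j.

Section HeisenbergTranslations.
Variable R : realType.
Implicit Types (s theta t : R) (g h a b : 'M[R[i]]_3) (z w : 'cV[R[i]]_3).

Definition expi theta : R[i] := cos theta +i* sin theta.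

(* w_3^* z_1 + w_2^* z_2 + w_1^* z_3 *)
Definition herm z w : R[i] := \sum_(i < 3) conjc (w (rev_ord i) 0) * z i 0.

Definition SU21 : set 'M[R[i]]_3 :=
  [set g | \det g = 1 /\ forall z w, herm (g *m z) (g *m w) = herm z w].

(* Products, unit and inverses are those of the matrix ring. *)
Definition is_subgroup_SU21 (H : set 'M[R[i]]_3) : Prop :=
  [/\ H `<=` SU21, H 1, forall g h, H g -> H h -> H (g * h)
    & forall g, H g -> H g^-1].

(* Meaningful for subsets of SU21 only (lemma generated_subgroup below):
   otherwise the intersection is over an empty family. *)
Definition generated (S : set 'M[R[i]]_3) : set 'M[R[i]]_3 :=
  smallest is_subgroup_SU21 S.

(* The subspace topology on G is discrete; R[i]^o is R[i] with the topology of
   its norm, and matrices carry the entrywise (product) topology. *)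
Definition is_discrete (G : set 'M[R[i]]_3) : Prop :=
  (G : set 'M[R[i]^o]_3) `<=` isolated (G : set 'M[R[i]^o]_3).

(* Words in a, a^-1, b, b^-1: the first boolean of a letter selects the
   generator (b when true), the second one its inverse. *)
Definition letter a b (x : bool * bool) : 'M[R[i]]_3 :=
  let g := if x.1 then b else a in if x.2 then g^-1 else g.

Definition word_value a b (u : seq (bool * bool)) : 'M[R[i]]_3 :=
  \prod_(x <- u) letter a b x.

Definition reduced (u : seq (bool * bool)) : bool :=
  sorted (fun x y => y != (x.1, ~~ x.2)) u.

(* The canonical map from the free group on two letters (the reduced words)
   to the group generated by a and b is bijective; in particular a != b. *)
Definition freely_generates a b : Prop :=
  forall g, generated [set a; b] g ->
    exists! u, reduced u /\ word_value a b u = g.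

Definition heis_infty s theta t : 'M[R[i]]_3 :=
  let q := (Num.sqrt 2 * s)%:C in
  mx3 [:: [:: 1; - q * expi (- theta); (- s ^+ 2) +i* t];
          [:: 0; 1                   ; q * expi theta  ];
          [:: 0; 0                   ; 1               ]].

Definition heis_o s theta t : 'M[R[i]]_3 :=
  let q := (Num.sqrt 2 * s)%:C in
  mx3 [:: [:: 1                ; 0                   ; 0];
          [:: q * expi theta   ; 1                   ; 0];
          [:: (- s ^+ 2) +i* t ; - q * expi (- theta); 1]].

(* The modulus |s^2 + i t|, as a real number. *)
Definition heis_mod s t : R := Normc.normc (s ^+ 2 +i* t).

Lemma expiN theta : expi (- theta) = conjc (expi theta).
Proof. by rewrite /expi cosN sinN. Qed.

Lemma expi_conj theta : expi theta * conjc (expi theta) = 1.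
Proof.
rewrite /expi; apply/eqP; rewrite eq_complex /=; apply/andP; split; apply/eqP.
  by rewrite -(cos2Dsin2 theta); ring.
by ring.
Qed.

Lemma conjcD (x y : R[i]) : conjc (x + y) = conjc x + conjc y.
Proof. exact: (rmorphD (@conjc R)). Qed.

Lemma conjcM (x y : R[i]) : conjc (x * y) = conjc x * conjc y.
Proof. exact: (rmorphM (@conjc R)). Qed.

Lemma conjcN (x : R[i]) : conjc (- x) = - conjc x.
Proof. exact: (rmorphN (@conjc R)). Qed.

Lemma mulmx3E g z (i : 'I_3) :
  (g *m z) i 0 = g i 0 * z 0 0 + g i 1 * z 1 0 + g i (1 + 1) * z (1 + 1) 0.
Proof.
rewrite mxE !big_ord_recr big_ord0 /= add0r.
by congr (g i _ * z _ 0 + g i _ * z _ 0 + g i _ * z _ 0); apply: val_inj.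
Qed.

Lemma hermE z w : herm z w =
  conjc (w (1 + 1) 0) * z 0 0 + 
    conjc (w 1 0) * z 1 0 + conjc (w 0 0) * z (1 + 1) 0.
Proof.
rewrite /herm !big_ord_recr big_ord0 /= add0r.
by congr (conjc (w _ 0) * z _ 0 + 
    conjc (w _ 0) * z _ 0 + conjc (w _ 0) * z _ 0);
  apply: val_inj.
Qed.

Lemma heis_quad s t :
  conjc ((- s ^+ 2) +i* t) =
  - (Num.sqrt 2 * s)%:C * (Num.sqrt 2 * s)%:C - ((- s ^+ 2) +i* t).
Proof.
have q2 : Num.sqrt (2 : R) * Num.sqrt 2 = 2 by rewrite -expr2 sqr_sqrtr.
have qq : Num.sqrt 2 * s * (Num.sqrt 2 * s) = 2 * s ^+ 2.
  by rewrite mulrACA q2.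
rewrite mulNr -rmorphM /= qq; apply/eqP; rewrite eq_complex /=.
by apply/andP; split; apply/eqP; ring.
Qed.

Lemma heis_infty_SU21 s theta t : SU21 (heis_infty s theta t).
Proof.
split.
  rewrite -det_tr det_trig.
    by rewrite !big_ord_recr big_ord0 /= !mxE /= !mulr1.
  apply/is_trig_mxP => i j; rewrite !mxE.
  by case: i => [[|[|[|i]]] Hi] //; case: j => [[|[|[|j]]] Hj].
move=> z w; rewrite !hermE !mulmx3E !mxE /= expiN.
have := heis_quad s t; have := conjc_real (Num.sqrt 2 * s).
have := expi_conj theta.
move: (expi theta) (_ +i* _) (_%:C) => e p q ee qJ pJ.
rewrite !(conjcD, conjcM, conjcN) conjc0 conjc1 conjcK qJ pJ.
pose E := e * conjc e - 1.
have E0 : E = 0 by rewrite /E ee subrr.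
set w0 := conjc (w 0 0); set w1 := conjc (w 1 0); set w2 := conjc (w _ 0).
set z0 := z 0 0; set z1 := z 1 0; set z2 := z _ 0.
transitivity (w2 * z0 + w1 * z1 + w0 * z2 + q * q * w2 * z2 * E); last first.
  by rewrite E0 mulr0 addr0.
by rewrite /E; ring.
Qed.

Lemma heis_o_SU21 s theta t : SU21 (heis_o s theta t).
Proof.
split.
  rewrite det_trig.
    by rewrite !big_ord_recr big_ord0 /= !mxE /= !mulr1.
  apply/is_trig_mxP => i j; rewrite !mxE.
  by case: i => [[|[|[|i]]] Hi] //; case: j => [[|[|[|j]]] Hj].
move=> z w; rewrite !hermE !mulmx3E !mxE /= expiN.
have := heis_quad s t; have := conjc_real (Num.sqrt 2 * s).
have := expi_conj theta.
move: (expi theta) (_ +i* _) (_%:C) => e p q ee qJ pJ.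
rewrite !(conjcD, conjcM, conjcN) conjc0 conjc1 conjcK qJ pJ.
pose E := e * conjc e - 1.
have E0 : E = 0 by rewrite /E ee subrr.
set w0 := conjc (w 0 0); set w1 := conjc (w 1 0); set w2 := conjc (w _ 0).
set z0 := z 0 0; set z1 := z 1 0; set z2 := z _ 0.
transitivity (w2 * z0 + w1 * z1 + w0 * z2 + q * q * w0 * z0 * E); last first.
  by rewrite E0 mulr0 addr0.
by rewrite /E; ring.
Qed.

Lemma SU21_subgroup : is_subgroup_SU21 SU21.
Proof.
split=> //.
- by split=> [|z w]; [exact: det1 | rewrite !mul1mx].
- move=> g h [dg Hg] [dh Hh]; split=> [|z w].
    by rewrite det_mulmx dg dh mulr1.
  by rewrite -!mulmxA Hg Hh.
- move=> g [dg Hg].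
  have ug : g \in unitmx by rewrite unitmxE dg unitr1.
  split=> [|z w]; first by rewrite det_inv dg invr1.
  by rewrite -[LHS]Hg !mulmxA !(mulmxV ug) !mul1mx.
Qed.

Lemma generated_subgroup (S : set 'M[R[i]]_3) :
  S `<=` SU21 -> is_subgroup_SU21 (generated S) /\ S `<=` generated S.
Proof.
move=> SS; split; last by move=> g Sg H [_]; apply.
split.
- by move=> g; apply; split => //; exact: SU21_subgroup.
- by move=> H [[]].
- by move=> g h Gg Gh H HH; case: (HH) => -[_ _ HM _] _; apply: HM;
    [exact: Gg | exact: Gh].
- by move=> g Gg H HH; case: (HH) => -[_ _ _ HV] _; apply: HV; exact: Gg.
Qed.

End HeisenbergTranslations.

(* Main.v *)
Require Import Defs.
From HB Require Import structures.
From mathcomp Require Import all_boot all_order all_algebra complex.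
From mathcomp Require Import all_classical all_reals all_analysis.
From mathcomp Require Import ring lra.

Import Order.TTheory GRing.Theory Num.Theory numFieldNormedType.Exports.

Local Open Scope classical_set_scope.
Local Open Scope ring_scope.

(** Both generators act on the isotropic vectors, and the group is free and
    discrete by ping-pong between the sets [F > 0] and [F < 0] for one suitable
    continuous function [F].  Under (1), [F > 0] is a Cygan ball centred at [o],
    and a translation moves it off itself as soon as it satisfies an inequality
    whose extremal case is a quartic minimised by Cardano's formula.  Under (2)
    and (4), [F > 0] is a slab orthogonal to the direction of [A], of the exact
    width that makes [A] move it off itself.  Under (2) it contains the
    isometric balls of [B] and of its inverse; under (4) its complement lies in
    the analogous slab for [B], seen after exchanging [o] and [infinity], because
    a product of three cosines of sum [d] is at most [cos (d / 3) ^ 3].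
    Condition (3) is (2) with the generators exchanged.  Powers of a generator never need
    separate estimates: for isotropic [z], [n |-> |(A^n z)_1|^2] is convex. *)

Set Implicit Arguments.
Unset Strict Implicit.
Unset Printing Implicit Defensive.

Local Notation re := complex.Re.
Local Notation im := complex.Im.
Local Notation "z @1" := (z 0 0) (at level 2, format "z @1").
Local Notation "z @2" := (z 1 0) (at level 2, format "z @2").
Local Notation "z @3" := (z (1 + 1) 0) (at level 2, format "z @3").

(** * Ping-pong *)

Section PingPong.
Local Open Scope complex_scope.
Variable R : realType.
Implicit Types (g h a b : 'M[R[i]]_3) (z p q : 'cV[R[i]]_3).
Implicit Types (x y l : bool * bool) (u v : seq (bool * bool)).

Definition isotropic z : Prop := z != 0 /\ herm z z = 0.

Definition opp_letter x : bool * bool := (x.1, ~~ x.2).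

Lemma opp_letterK : involutive opp_letter.
Proof. by case=> c e; rewrite /opp_letter /= negbK. Qed.

Lemma SU21_unit g : SU21 g -> g \is a GRing.unit.
Proof. by case=> dg _; rewrite unitmxE dg unitr1. Qed.

Lemma SU21_isotropic g z : SU21 g -> isotropic z -> isotropic (g *m z).
Proof.
move=> Sg [z0 Hz]; split; last by case: Sg => _ ->.
apply: contra z0 => /eqP gz; rewrite -[z]mul1mx.
by rewrite -(mulVmx (SU21_unit Sg)) -mulmxA gz mulmx0.
Qed.

Lemma SU21X g n : SU21 g -> SU21 (g ^+ n).
Proof.
have [_ H1 HM _] := @SU21_subgroup R.
by move=> Sg; elim: n => [|n IH]; rewrite ?expr0 // exprS; apply: HM.
Qed.

Section Words.
Variables a b : 'M[R[i]]_3.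
Hypotheses (aS : SU21 a) (bS : SU21 b).

Lemma letter_SU21 x : SU21 (letter a b x).
Proof.
have [_ _ _ HV] := @SU21_subgroup R.
by rewrite /letter; case: x => [[] []] /=; auto.
Qed.

Lemma letterV x : letter a b (opp_letter x) = (letter a b x)^-1.
Proof. by case: x => [c []]; rewrite /letter //= invrK. Qed.

Lemma letterK x : letter a b (opp_letter x) * letter a b x = 1.
Proof. by rewrite letterV mulVr //; apply: SU21_unit; exact: letter_SU21. Qed.

Lemma word_cons x u : word_value a b (x :: u) = letter a b x * word_value a b u.
Proof. by rewrite /word_value big_cons. Qed.

Lemma word_cat u v :
  word_value a b (u ++ v) = word_value a b u * word_value a b v.
Proof. by rewrite /word_value big_cat. Qed.

Lemma word_rcons u l :
  word_value a b (rcons u l) = word_value a b u * letter a b l.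
Proof. by rewrite -cats1 /word_value big_cat /= big_cons big_nil mulr1. Qed.

Lemma word_SU21 u : SU21 (word_value a b u).
Proof.
have [_ H1 HM _] := @SU21_subgroup R.
elim: u => [|x u IH]; first by rewrite /word_value big_nil.
by rewrite word_cons; apply: HM => //; exact: letter_SU21.
Qed.

Lemma wordV u : exists v, word_value a b v = (word_value a b u)^-1.
Proof.
elim: u => [|x u [v Hv]].
  by exists [::]; rewrite /word_value big_nil invr1.
exists (v ++ [:: opp_letter x]).
rewrite word_cat !word_cons Hv letterV /word_value big_nil mulr1 invrM //.
  exact/SU21_unit/letter_SU21.
exact/SU21_unit/word_SU21.
Qed.

Lemma word_reduce u :
  exists2 v, reduced v & word_value a b v = word_value a b u.
Proof.
elim: u => [|x u [[|y v] rv Hv]]; first by exists [::].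
  by exists [:: x]; rewrite // !word_cons Hv.
have [yx|yx] := eqVneq y (opp_letter x); last first.
  exists (x :: y :: v); last by rewrite [LHS]word_cons Hv word_cons.
  by move: rv; rewrite /reduced /= yx.
exists v; first by move: rv; rewrite /reduced /=; apply: path_sorted.
by rewrite word_cons -Hv word_cons yx mulrA -{1}[x]opp_letterK letterK mul1r.
Qed.

Lemma generated_word g :
  generated [set a; b] g -> exists2 u, reduced u & word_value a b u = g.
Proof.
pose H := [set g | exists u, word_value a b u = g].
move=> /(_ H) [|u <-]; last exact: word_reduce.
split; last first.
  move=> h [->|->]; [exists [:: (false, false)]|exists [:: (true, false)]];
  by rewrite word_cons /word_value big_nil mulr1.
split.
- by move=> h [u <-]; exact: word_SU21.
- by exists [::]; rewrite /word_value big_nil.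
- by move=> h h' [u <-] [v <-]; exists (u ++ v); rewrite word_cat.
- by move=> h [u <-]; exact: wordV.
Qed.

Variable F : 'cV[R[i]]_3 -> R.

(** [side c] is the set from which the generator selected by [c] and its inverse push points out:
    [F > 0] for [a], [F < 0] for [b]. *)
Definition side (c : bool) z : Prop :=
  isotropic z /\ (if c then F z < 0 else 0 < F z).

Hypothesis push : forall x n z, side x.1 z ->
  side (~~ x.1) (letter a b x ^+ n.+1 *m z).
Hypothesis side_ex : exists z, side false z.

(** A side only records a generator. Taking images under all positive powers of one letter also
    separates that letter from its inverse, and keeps the set stable when the letter is repeated. *)
Definition attracted x p : Prop :=
  exists n q, side x.1 q /\ p = letter a b x ^+ n.+1 *m q.

Lemma side_disj c z : side c z -> side (~~ c) z -> False.
Proof. by case: c => -[_ /= h1] [_ /= h2]; lra. Qed.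

Lemma side_any c : exists z, side c z.
Proof.
case: side_ex => z sz; case: c; last by exists z.
by have := push (x := (false, false)) 0 sz; exists (letter a b (false, false) ^+ 1 *m z).
Qed.

Lemma attracted_side x p : attracted x p -> side (~~ x.1) p.
Proof. by move=> [n [q [sq ->]]]; exact: push. Qed.

Lemma attracted1 x p : side x.1 p -> attracted x (letter a b x *m p).
Proof. by move=> sp; exists 0%N, p; rewrite expr1. Qed.

(** If [x] and [y] select different generators, then [p] already lies on the side from which [x]
    pushes. Otherwise reducedness forces [y = x] and the exponent grows by one. *)
Lemma attracted_step x y p :
  y != opp_letter x -> attracted y p -> attracted x (letter a b x *m p).
Proof.
move=> yx yp; have [xy|xy] := eqVneq y.1 x.1; last first.
  by apply/attracted1; move: (attracted_side yp) xy; case: x.1; case: y.1.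
have <- : y = x.
  by case: x y yx xy {yp} => [c e] [c' e'] + /= cc; rewrite cc /opp_letter /=;
     rewrite xpair_eqE eqxx /=; case: e; case: e'.
move: yp => [n [q [sq ->]]]; exists n.+1, q; split=> //.
by rewrite mulmxA [in RHS]exprS.
Qed.

(** Letters of different generators attract to opposite sides. For mutually inverse letters, a
    common point would yield a positive power of [x] mapping a point of its side back into that
    side. *)
Lemma attracted_disj x y p :
  x != y -> attracted x p -> attracted y p -> False.
Proof.
move=> xy xp yp; have [e|e] := eqVneq x.1 y.1; last first.
  by move: (attracted_side xp) (attracted_side yp) e;
    case: x.1; case: y.1 => //= s1 s2 _; apply: (side_disj s1).
have yx : y = opp_letter x.
  by case: x y xy e {xp yp} => [c [] [c' []]] /= + cc; rewrite cc ?eqxx.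
move: xp yp => [n [q [sq ->]]] [m [r [sr]]].
rewrite {}yx /= in sr *; rewrite letterV exprVn => /(congr1 (mulmx (letter a b x ^+ m.+1))).
rewrite !mulmxA mulmxV; last exact/SU21_unit/SU21X/letter_SU21.
rewrite mul1mx => qr.
have := push (x := x) (m.+1 + n) sq.
rewrite -addnS exprD [_ * _]/(_ *m _) qr; exact: side_disj.
Qed.

Lemma word_attracted x u l p : reduced (x :: rcons u l) -> side l.1 p ->
  attracted x (word_value a b (x :: rcons u l) *m p).
Proof.
move=> + sp; elim: u x => [|y u IH] x.
  rewrite /reduced /= andbT => lx; rewrite !word_cons /word_value big_nil mulr1.
  by rewrite -mulmxA; apply: attracted_step lx _; exact: attracted1.
rewrite rcons_cons /reduced /= => /andP[yx ryu].
by rewrite word_cons -mulmxA; apply: attracted_step yx _; apply: IH.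
Qed.

Lemma letter_avoid x y : exists l, (l != x) && (l != y).
Proof.
pose s : seq (bool * bool) := [:: (true, true); (true, false); (false, true)].
have /hasP[l _ Hl] : has (fun l => (l != x) && (l != y)) s.
  by case: x y => [[] []] [[] []].
by exists l.
Qed.

Lemma reduced_rcons x u l :
  reduced (x :: u) -> l != opp_letter (last x u) -> reduced (x :: rcons u l).
Proof. by rewrite /reduced /= rcons_path => -> ->. Qed.

Lemma reduced_cons x u : reduced (x :: u) -> reduced u.
Proof. exact: path_sorted. Qed.

(** A letter [l] is appended that keeps the word reduced and differs from [x]. If the word had value
    1, the image of a point under [l] would be attracted both by [l] and by [x]. *)
Lemma word_neq1 x u : reduced (x :: u) -> word_value a b (x :: u) != 1.
Proof.
move=> rxu; have [l /andP[lx lu]] := letter_avoid x (opp_letter (last x u)).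
have [p sp] := side_any l.1; apply/eqP => w1.
have := word_attracted (reduced_rcons rxu lu) sp.
rewrite -rcons_cons word_rcons w1 mul1r.
by move=> xp; apply: attracted_disj lx (attracted1 sp) xp.
Qed.

Lemma word_neq x y u v : x != y -> reduced (x :: u) -> reduced (y :: v) ->
  word_value a b (x :: u) != word_value a b (y :: v).
Proof.
move=> xy ru rv.
have [l /andP[lu lv]] :=
  letter_avoid (opp_letter (last x u)) (opp_letter (last y v)).
have [p sp] := side_any l.1; apply/eqP => uv.
have := word_attracted (reduced_rcons ru lu) sp.
have := word_attracted (reduced_rcons rv lv) sp.
rewrite -!rcons_cons !word_rcons uv => yp xp.
exact: attracted_disj xy xp yp.
Qed.

Lemma word_inj u v : reduced u -> reduced v ->
  word_value a b u = word_value a b v -> u = v.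
Proof.
elim: u v => [|x u IH] [|y v] ru rv //.
- by move/esym/eqP; rewrite {2}/word_value big_nil (negbTE (word_neq1 rv)).
- by move/eqP; rewrite {2}/word_value big_nil (negbTE (word_neq1 ru)).
- have [xy|xy] := eqVneq x y; last by move/eqP; rewrite (negbTE (word_neq xy ru rv)).
  rewrite -xy !word_cons => e; congr (_ :: _).
  apply: IH; [exact: reduced_cons ru|exact: reduced_cons rv|].
  by move: e; apply: mulrI; exact/SU21_unit/letter_SU21.
Qed.

Lemma pingpong_free : freely_generates a b.
Proof.
move=> g /generated_word[u ru ug]; exists u; split=> // v [rv vg].
by apply: word_inj => //; rewrite ug vg.
Qed.

Hypothesis F_cont : forall h z,
  continuous (fun g : 'M[R[i]^o]_3 => F (h *m (g : 'M[R[i]]_3) *m z)).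

(* If [g^-1 * g'] is close to [1], it moves a point [l *m p] attracted by [l]
   so little that the image is still attracted by [l]; this excludes every
   reduced word whose first letter is not [l]. *)
Lemma pingpong_discrete : is_discrete (generated [set a; b]).
Proof.
move=> g Gg.
have [u [ru ug]] : exists u, reduced u /\ word_value a b u = g.
  by have [u ru ug] := generated_word Gg; exists u.
have gU : g \is a GRing.unit by rewrite -ug; exact/SU21_unit/word_SU21.
have := side_any.
move=> /choice[p sp].
(* At [h = g] this is [p l.1]. The sides are open conditions on isotropic vectors, so it stays on
   [side l.1] for [h] near [g], uniformly in the finitely many letters. *)
pose f l (h : 'M[R[i]]_3) := (letter a b l)^-1 * g^-1 *m h *m (letter a b l *m p l.1).
have fside l : \forall h \near (g : 'M[R[i]^o]_3), 
    SU21 h -> side l.1 (f l (h : 'M[R[i]]_3)).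
  have lU : letter a b l \is a GRing.unit by exact/SU21_unit/letter_SU21.
  have flg : f l g = p l.1.
    have -> : f l g = ((letter a b l)^-1 * g^-1 * g * letter a b l) *m p l.1.
      by rewrite /f mulmxA.
    by rewrite -(mulrA _ _^-1) mulVr // mulr1 mulVr // mul1mx.
  have fiso h : SU21 h -> isotropic (f l h).
    move=> Sh; rewrite /f; apply: SU21_isotropic.
      have [_ _ HM HV] := @SU21_subgroup R.
      apply: (HM) => //; apply: (HM); apply: (HV); first exact: letter_SU21.
      by rewrite -ug; exact: word_SU21.
    by apply: SU21_isotropic; [exact: letter_SU21|case: (sp l.1)].
  have : (fun h : 'M[R[i]^o]_3 => F (f l (h : 'M[R[i]]_3))) @ (g : 'M[R[i]^o]_3)
      --> F (p l.1).
    by rewrite -flg; exact: F_cont.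
  case: (sp l.1) => _; case: (l.1) => pl cl.
    have : \forall h \near (g : 'M[R[i]^o]_3), F (f l h) < 0.
      exact: (cl _ (lt_nbhsl pl)).
    by apply: filterS => h ? Sh; split=> //; exact: fiso.
  have : \forall h \near (g : 'M[R[i]^o]_3), 0 < F (f l h).
    exact: (cl _ (lt_nbhsr pl)).
  by apply: filterS => h ? Sh; split=> //; exact: fiso.
have nb : \forall h \near (g : 'M[R[i]^o]_3), SU21 h -> forall l, side l.1 (f l h).
  have Fg : Filter (nbhs (g : 'M[R[i]^o]_3)) by exact: nbhs_filter.
  have := @filter_forall _ _
    (fun l h => SU21 h -> side l.1 (f l (h : 'M[R[i]]_3))) _ Fg fside.
  by apply: filterS => h Vh Sh l; exact: Vh.
split; first exact/mem_set.
exists [set h | SU21 h -> forall l, side l.1 (f l h)]; first exact: nb.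
apply/seteqP; split=> [h [/= Vh /generated_word[w _ wh]]|_ ->]; last first.
  by split=> //=; apply: nbhs_singleton nb.
have Sh : SU21 h by rewrite -wh; exact: word_SU21.
have [v vg] := wordV u.
have [w' rw w'h] := word_reduce (v ++ w).
have {w'h vg} : word_value a b w' = g^-1 * h by rewrite w'h word_cat vg ug wh.
case: w' rw => [_|x w' rw] w'h.
  by rewrite -[h]mul1r -(mulrV gU) -mulrA -w'h /word_value big_nil mulr1.
have [l /andP[lx lw]] := letter_avoid x (opp_letter (last x w')).
have := word_attracted (reduced_rcons rw lw) (sp l.1).
rewrite -rcons_cons word_rcons w'h.
have -> : g^-1 * h * letter a b l *m p l.1 = letter a b l *m f l h.
  have -> : f l h = ((letter a b l)^-1 * g^-1 * h * letter a b l) *m p l.1.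
    by rewrite /f mulmxA.
  rewrite mulmxA.
  rewrite -[X in _ = X *m _]/(letter a b l *
    ((letter a b l)^-1 * g^-1 * h * letter a b l)).
  by rewrite !mulrA mulrV ?mul1r //; exact/SU21_unit/letter_SU21.
move=> xp; exfalso; apply: attracted_disj lx (attracted1 _) xp.
exact: Vh.
Qed.

End Words.
End PingPong.

(** * Continuity of orbit maps *)

Section Continuity.
Local Open Scope complex_scope.
Variable R : realType.

Lemma re_continuous : continuous (fun x : R[i]^o => re (x : R[i]) : R).
Proof.
move=> x A /nbhs_ballP[e /= e0 eA]; apply/(@nbhs_ballP _ R[i]^o).
exists e%:C; first by rewrite /= ltcR.
move=> y /= xy; apply: eA; rewrite /ball /= -ltcR; apply: le_lt_trans xy.
have := normc_ge_Re ((x : R[i]) - y).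
by case: (x : R[i]) (y : R[i]) => [a b] [c d].
Qed.

Lemma im_continuous : continuous (fun x : R[i]^o => im (x : R[i]) : R).
Proof.
move=> x A /nbhs_ballP[e /= e0 eA]; apply/(@nbhs_ballP _ R[i]^o).
exists e%:C; first by rewrite /= ltcR.
move=> y /= xy; apply: eA; rewrite /ball /= -ltcR; apply: le_lt_trans xy.
(* Multiplication by ['i] turns the imaginary part into a real part up to sign and preserves the
   modulus. *)
have := normc_ge_Re (((x : R[i]) - y) * 'i%C).
rewrite normrM (_ : `|'i%C : R[i]| = 1) ?mulr1; last first.
  by rewrite normc_def /= expr0n /= add0r expr1n sqrtr1.
rewrite ReiNIm normrN.
by case: (x : R[i]) (y : R[i]) => [a b] [c d].
Qed.

Lemma mulmx_coord_continuous (P : 'M[R[i]]_3) (z : 'cV[R[i]]_3) i :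
  continuous (fun g : 'M[R[i]^o]_3 => (P *m (g : 'M[R[i]]_3) *m z) i 0 : R[i]^o).
Proof.
rewrite (_ : (fun _ => _) = (fun g : 'M[R[i]^o]_3 =>
   \sum_j (\sum_k P i k * (g : 'M[R[i]]_3) k j) * z j 0 : R[i]^o)); last first.
  by apply/funext => g; rewrite mxE; under eq_bigr do rewrite mxE.
apply: continuous_big; first exact: add_continuous.
move=> j _ g.
have cj : (fun g : 'M[R[i]^o]_3 => \sum_k P i k * (g : 'M[R[i]]_3) k j : R[i]^o) @ g
    --> (\sum_k P i k * (g : 'M[R[i]]_3) k j : R[i]^o).
  move: g; apply: continuous_big; first exact: add_continuous.
  move=> k _ g.
  have ck : (fun g : 'M[R[i]^o]_3 => g k j) @ g --> g k j.
    exact: coord_continuous.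
  exact: cvgMl_tmp ck.
exact: cvgMr_tmp cj.
Qed.

End Continuity.

(** * Heisenberg translations acting on isotropic vectors *)

Section HeisenbergMatrices.
Local Open Scope complex_scope.
Variable R : realType.
Implicit Types (s th t : R) (z : 'cV[R[i]]_3) (x y : R[i]).

Definition nsq x : R := re x ^+ 2 + im x ^+ 2.

Lemma nsq_ge0 x : 0 <= nsq x.
Proof. by rewrite addr_ge0 // sqr_ge0. Qed.

Lemma nsq_eq0 x : (nsq x == 0) = (x == 0).
Proof.
by case: x => a b; rewrite /nsq /= paddr_eq0 ?sqr_ge0 // !sqrf_eq0 eq_complex.
Qed.

Lemma nsq_gt0 x : (0 < nsq x) = (x != 0).
Proof. by rewrite lt_def nsq_ge0 andbT nsq_eq0. Qed.

Lemma nsqM x y : nsq (x * y) = nsq x * nsq y.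
Proof. by case: x y => [a b] [c d]; rewrite /nsq /=; ring. Qed.

Lemma parallelogram x y : nsq (x + y) + nsq (x - y) = 2 * nsq x + 2 * nsq y.
Proof. by case: x y => [a b] [c d]; rewrite /nsq /=; ring. Qed.

(** The inversion exchanging [o] and infinity, which conjugates [heis_infty] to [heis_o]. Its
    determinant is -1, so it is outside [SU21] although it preserves [herm]. *)
Definition swap : 'M[R[i]]_3 := \matrix_(i, j) (j == rev_ord i)%:R.

Lemma swapE z i : (swap *m z) i 0 = z (rev_ord i) 0.
Proof.
rewrite mxE (bigD1 (rev_ord i)) //= !mxE eqxx mul1r big1 ?addr0 // => j ji.
by rewrite mxE (negbTE ji) mul0r.
Qed.

Lemma colP3 z z' : z@1 = z'@1 -> z@2 = z'@2 -> z@3 = z'@3 -> z = z'.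
Proof.
move=> e1 e2 e3; apply/colP => -[[|[|[|i]]] Hi] //.
- by move: e1; congr (z _ 0 = z' _ 0); apply: val_inj.
- by move: e2; congr (z _ 0 = z' _ 0); apply: val_inj.
- by move: e3; congr (z _ 0 = z' _ 0); apply: val_inj.
Qed.

Lemma swap1 z : (swap *m z)@1 = z@3.
Proof. by rewrite swapE; congr (z _ 0); apply: val_inj. Qed.

Lemma swap2 z : (swap *m z)@2 = z@2.
Proof. by rewrite swapE; congr (z _ 0); apply: val_inj. Qed.

Lemma swap3 z : (swap *m z)@3 = z@1.
Proof. by rewrite swapE; congr (z _ 0); apply: val_inj. Qed.

Lemma swapK z : swap *m (swap *m z) = z.
Proof. by apply/colP => i; rewrite !swapE rev_ordK. Qed.

Lemma herm_swap z w : herm (swap *m z) (swap *m w) = herm z w.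
Proof. by rewrite !hermE !swap1 !swap2 !swap3; ring. Qed.

Lemma isotropic_swap z : isotropic z -> isotropic (swap *m z).
Proof.
move=> [z0 hz]; split; last by rewrite herm_swap.
by apply: contra z0 => /eqP e; rewrite -[z]swapK e mulmx0.
Qed.

Lemma isotropicE z : isotropic z ->
  nsq z@2 = - 2 * (re z@1 * re z@3 + im z@1 * im z@3).
Proof.
move=> [_]; rewrite hermE /nsq; case: z@1 z@2 z@3 => [a b] [c d] [e f] /=.
by move=> [h _]; lra.
Qed.

Lemma heis_infty1 s th t z : (heis_infty s th t *m z)@1 =
  z@1 - (Num.sqrt 2 * s)%:C * expi (- th) * z@2 + (- s ^+ 2 +i* t) * z@3.
Proof. by rewrite mulmx3E !mxE /=; ring. Qed.

Lemma heis_infty2 s th t z : (heis_infty s th t *m z)@2 =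
  z@2 + (Num.sqrt 2 * s)%:C * expi th * z@3.
Proof. by rewrite mulmx3E !mxE /=; ring. Qed.

Lemma heis_infty3 s th t z : (heis_infty s th t *m z)@3 = z@3.
Proof. by rewrite mulmx3E !mxE /=; ring. Qed.

Lemma heis_oE s th t z :
  heis_o s th t *m z = swap *m (heis_infty s th t *m (swap *m z)).
Proof.
apply: colP3; rewrite ?swap1 ?swap2 ?swap3 ?heis_infty1 ?heis_infty2 ?heis_infty3.
all: rewrite ?swap1 ?swap2 ?swap3 mulmx3E !mxE /=; ring.
Qed.

Lemma mulmxXS (g : 'M[R[i]]_3) n z : g ^+ n.+1 *m z = g *m (g ^+ n *m z).
Proof. by rewrite mulmxA [in LHS]exprS. Qed.

Lemma heis_oX s th t n z :
  (heis_o s th t ^+ n *m z) = swap *m (heis_infty s th t ^+ n *m (swap *m z)).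
Proof.
elim: n => [|n IH]; first by rewrite !expr0 !mul1mx swapK.
rewrite (mulmxXS (heis_o s th t)) IH heis_oE swapK; congr (swap *m _).
by rewrite (mulmxXS (heis_infty s th t)).
Qed.

Lemma heis_inftyK s th t z :
  heis_infty (- s) th (- t) *m (heis_infty s th t *m z) = z.
Proof.
have ee : expi th * expi (- th) = 1 :> R[i] by rewrite expiN expi_conj.
have q2 : Num.sqrt (2 : R) * Num.sqrt 2 = 2 by rewrite -expr2 sqr_sqrtr.
have qq : (Num.sqrt 2 * s)%:C * (Num.sqrt 2 * s)%:C =
    - (- s ^+ 2 +i* t) - (- (- s) ^+ 2 +i* - t) :> R[i].
  by apply/eqP; rewrite eq_complex /= mulrACA q2; apply/andP; split; apply/eqP; ring.
have qN : (Num.sqrt 2 * - s)%:C = - (Num.sqrt 2 * s)%:C :> R[i].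
  by rewrite mulrN rmorphN.
apply: colP3; rewrite ?heis_infty1 ?heis_infty2 ?heis_infty3 // qN; last by ring.
move: ee qq; move: (expi th) (expi (- th)) (_%:C) (_ +i* _) (_ +i* _).
move=> e e' q p p' ee qq.
transitivity (z@1 + (p + p' + q * q * (e * e')) * z@3); first by ring.
by rewrite ee mulr1 qq; ring.
Qed.

(** The inverse keeps the angle and negates [s] and [t], so an estimate proved for every real [s]
    serves a generator and its inverse alike. *)
Lemma heis_inftyV s th t :
  (heis_infty s th t)^-1 = heis_infty (- s) th (- t) :> 'M[R[i]]_3.
Proof.
have e : heis_infty (- s) th (- t) * heis_infty s th t = 1 :> 'M[R[i]]_3.
  apply/matrixP => i j; have := heis_inftyK s th t (delta_mx j 0).
  by move/colP => /(_ i); rewrite mulmxA -colE !mxE eqxx andbT.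
have u := SU21_unit (heis_infty_SU21 s th t).
by rewrite -[LHS]mul1r -e -mulrA mulrV // mulr1.
Qed.

Lemma heis_oV s th t : (heis_o s th t)^-1 = heis_o (- s) th (- t) :> 'M[R[i]]_3.
Proof.
have e : heis_o (- s) th (- t) * heis_o s th t = 1 :> 'M[R[i]]_3.
  apply/matrixP => i j.
  have : heis_o (- s) th (- t) *m (heis_o s th t *m (delta_mx j 0 : 'cV_3)) = delta_mx j 0.
    by rewrite (heis_oE (- s)) (heis_oE s) swapK heis_inftyK swapK.
  by move/colP => /(_ i); rewrite mulmxA -colE !mxE eqxx andbT.
have u := SU21_unit (heis_o_SU21 s th t).
by rewrite -[LHS]mul1r -e -mulrA mulrV // mulr1.
Qed.

(* Parallelogram law, and isotropy: [Re (z1 * conj z3) <= 0], so that adding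
   [- s^2 * z3] to [z1] does not decrease its modulus. *)
Lemma heis_infty_convex s th t z : isotropic z ->
  2 * nsq z@1 <=
  nsq (heis_infty s th t *m z)@1 + nsq (heis_infty (- s) th (- t) *m z)@1.
Proof.
move=> /isotropicE hz; rewrite !heis_infty1.
set b := (- s ^+ 2)%:C * z@3.
set a := - ((Num.sqrt 2 * s)%:C * expi (- th) * z@2) + (0 +i* t) * z@3.
have -> : z@1 - (Num.sqrt 2 * s)%:C * expi (- th) * z@2 +
    (- s ^+ 2 +i* t) * z@3 = (z@1 + b) + a.
  have -> : (- s ^+ 2 +i* t) = (- s ^+ 2)%:C + (0 +i* t).
    by apply/eqP; rewrite eq_complex /=; apply/andP; split; apply/eqP; ring.
  by rewrite /a /b; ring.
have -> : z@1 - (Num.sqrt 2 * - s)%:C * expi (- th) * z@2 +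
    (- (- s) ^+ 2 +i* - t) * z@3 = (z@1 + b) - a.
  have -> : (- (- s) ^+ 2 +i* - t) = (- s ^+ 2)%:C - (0 +i* t).
    by apply/eqP; rewrite eq_complex /=; apply/andP; split; apply/eqP; ring.
  by rewrite mulrN rmorphN /a /b /=; ring.
rewrite parallelogram; have a0 := nsq_ge0 a.
suff : nsq z@1 <= nsq (z@1 + b) by lra.
have z20 := nsq_ge0 z@2; have z30 := nsq_ge0 z@3.
rewrite /b; move: hz z20 z30; rewrite /nsq.
case: z@1 z@2 z@3 => [a1 b1] [a2 b2] [a3 b3] /= -> h h3.
have : 0 <= s ^+ 2 * (- 2 * (a1 * a3 + b1 * b3)) by rewrite mulr_ge0 // sqr_ge0.
have : 0 <= s ^+ 4 * (a3 ^+ 2 + b3 ^+ 2) by rewrite mulr_ge0 // exprn_even_ge0.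
set l := s ^+ 4 * _; set m := s ^+ 2 * _ => l0 m0.
rewrite -subr_ge0; rewrite [leRHS](_ : _ = l + m); first exact: addr_ge0.
by rewrite /l /m; ring.
Qed.

Lemma convex_seq_le (u : nat -> R) :
  (forall n, 2 * u n.+1 <= u n + u n.+2) -> u 0 <= u 1 ->
  forall n, u 1 - u 0 <= u n.+1 - u n.
Proof.
move=> cu u01; elim=> [|n IH]; first by rewrite lexx.
by have := cu n; lra.
Qed.

Lemma convex_seq_nondecreasing (u : nat -> R) :
  (forall n, 2 * u n.+1 <= u n + u n.+2) -> u 0 <= u 1 ->
  forall n, u 1 <= u n.+1.
Proof.
move=> cu u01; elim=> // n IH.
by have := convex_seq_le cu u01 n.+1; lra.
Qed.

Lemma heis_inftyX_isotropic s th t n z :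
  isotropic z -> isotropic (heis_infty s th t ^+ n *m z).
Proof. by apply: SU21_isotropic; apply: SU21X; exact: heis_infty_SU21. Qed.

(** This is [heis_infty_convex] at the point of index [n.+1], whose images under the translation and
    its inverse are the two neighbours in the orbit. *)
Lemma heis_inftyX_convex s th t z n : isotropic z ->
  let u n := nsq (heis_infty s th t ^+ n *m z)@1 in
  2 * u n.+1 <= u n + u n.+2.
Proof.
move=> hz /=; have := heis_infty_convex s th t
  (heis_inftyX_isotropic s th t n.+1 hz).
by rewrite mulmxXS heis_inftyK -!mulmxXS addrC.
Qed.

Lemma heis_inftyX3 s th t n z : (heis_infty s th t ^+ n *m z)@3 = z@3.
Proof.
elim: n => [|n IH]; first by rewrite expr0 mul1mx.
by rewrite mulmxXS heis_infty3.
Qed.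

End HeisenbergMatrices.

(** * Ping-pong data given by the sign of a continuous function *)

Section Schottky.
Local Open Scope complex_scope.
Variable R : realType.
Implicit Types (s th t : R) (z : 'cV[R[i]]_3) (F : 'cV[R[i]]_3 -> R).
Implicit Types (a b g : 'M[R[i]]_3).

Definition orbit_continuous F : Prop := forall h z,
  continuous (fun g : 'M[R[i]^o]_3 => F (h *m (g : 'M[R[i]]_3) *m z)).

Lemma orbit_continuous_cst k : orbit_continuous (fun=> k).
Proof. by move=> h z; exact: cst_continuous. Qed.

Lemma orbit_continuous_re i : orbit_continuous (fun z => re (z i 0)).
Proof.
move=> h z g.
exact: (@continuous_comp _ R[i]^o _
  (fun g : 'M[R[i]^o]_3 => (h *m (g : 'M[R[i]]_3) *m z) i 0) (@complex.Re R) g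
  (@mulmx_coord_continuous R h z i g) (@re_continuous R _)).
Qed.

Lemma orbit_continuous_im i : orbit_continuous (fun z => im (z i 0)).
Proof.
move=> h z g.
exact: (@continuous_comp _ R[i]^o _
  (fun g : 'M[R[i]^o]_3 => (h *m (g : 'M[R[i]]_3) *m z) i 0) (@complex.Im R) g
  (@mulmx_coord_continuous R h z i g) (@im_continuous R _)).
Qed.

Lemma orbit_continuousD F G : orbit_continuous F -> orbit_continuous G ->
  orbit_continuous (fun z => F z + G z).
Proof. by move=> cF cG h z g; exact: (cvgD (cF h z g) (cG h z g)). Qed.

Lemma orbit_continuousB F G : orbit_continuous F -> orbit_continuous G ->
  orbit_continuous (fun z => F z - G z).
Proof. by move=> cF cG h z g; exact: (cvgB (cF h z g) (cG h z g)). Qed.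

Lemma orbit_continuousM F G : orbit_continuous F -> orbit_continuous G ->
  orbit_continuous (fun z => F z * G z).
Proof. by move=> cF cG h z g; exact: (cvgM (cF h z g) (cG h z g)). Qed.

Lemma orbit_continuous_norm F : orbit_continuous F ->
  orbit_continuous (fun z => `|F z|).
Proof. by move=> cF h z g; exact: (cvg_norm (cF h z g)). Qed.

Lemma orbit_continuous_nsq i : orbit_continuous (fun z => nsq (z i 0)).
Proof.
have re_c := @orbit_continuous_re i; have im_c := @orbit_continuous_im i.
exact: (orbit_continuousD (orbit_continuousM re_c re_c)
  (orbit_continuousM im_c im_c)).
Qed.

Definition expels g F : Prop := forall n z,
  isotropic z -> 0 < F z -> F (g ^+ n.+1 *m z) < 0.

Definition schottky a b : Prop := exists F,
  [/\ orbit_continuous F, (exists2 z, isotropic z & 0 < F z),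
      expels a F /\ expels a^-1 F
    & expels b (fun z => - F z) /\ expels b^-1 (fun z => - F z)].

Lemma schottky_free_discrete a b : SU21 a -> SU21 b -> schottky a b ->
  is_discrete (generated [set a; b]) /\ freely_generates a b.
Proof.
move=> Sa Sb [F [cF [z0 z0i Fz0] [aF aVF] [bF bVF]]].
have push x n z : side F x.1 z ->
    side F (~~ x.1) (letter a b x ^+ n.+1 *m z).
  move=> [zi Fz]; split.
    by apply: SU21_isotropic zi; apply: SU21X; exact: letter_SU21.
  move: x Fz => [[] []] /= Fz; rewrite /letter /=.
  - by rewrite -oppr_lt0; apply: bVF => //; rewrite oppr_gt0.
  - by rewrite -oppr_lt0; apply: bF => //; rewrite oppr_gt0.
  - exact: aVF.
  - exact: aF.
have ex : exists z, side F false z by exists z0.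
by split; [exact: pingpong_discrete push ex cF|exact: pingpong_free push ex].
Qed.

Lemma orbit_continuous_mulmx F (g : 'M[R[i]]_3) : orbit_continuous F ->
  orbit_continuous (fun z => F (g *m z)).
Proof.
move=> cF h z; rewrite (_ : (fun _ => _) =
  (fun x : 'M[R[i]^o]_3 => F ((g *m h) *m (x : 'M[R[i]]_3) *m z))).
  exact: cF.
by apply/funext => x; rewrite !mulmxA.
Qed.

Lemma expels_infty_swap F s th t :
  expels (heis_o s th t) (fun z => - F z) ->
  expels (heis_infty s th t) (fun z => - F (swap R *m z)).
Proof.
move=> H n z zi Fz.
have := H n (swap R *m z) (isotropic_swap zi).
by rewrite (heis_oX s th t n.+1) (swapK z); apply.
Qed.

Lemma expels_o_swap F s th t :
  expels (heis_infty s th t) F ->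
  expels (heis_o s th t) (fun z => F (swap R *m z)).
Proof.
move=> H n z zi Fz; rewrite (heis_oX s th t n.+1) swapK.
by apply: H => //; exact: isotropic_swap.
Qed.

(** Conjugating by [swap] exchanges the two kinds of translations. The first generator must expel
    the positive set, so the function also changes sign. *)
Lemma schottky_swap s1 th1 t1 s2 th2 t2 :
  schottky (heis_infty s2 th2 t2) (heis_o s1 th1 t1) ->
  schottky (heis_infty s1 th1 t1) (heis_o s2 th2 t2).
Proof.
rewrite /schottky !heis_inftyV !heis_oV.
move=> [F [cF [z0 z0i Fz0] [aF aVF] [bF bVF]]].
exists (fun z => - F (swap R *m z)); split.
- have := orbit_continuousB (@orbit_continuous_cst 0)
    (@orbit_continuous_mulmx _ (swap R) cF).
  by rewrite (_ : (fun z => 0 - _) = fun z => - F (swap R *m z)) //;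
    apply/funext => z; rewrite sub0r.
(* The translation expels [z0] from [F > 0], which supplies a point where [F] is negative. *)
- exists (swap R *m (heis_infty s2 th2 t2 ^+ 1 *m z0)).
    by apply: isotropic_swap; exact: heis_inftyX_isotropic.
  by rewrite (swapK (_ *m z0)) oppr_gt0; exact: aF.
- by split; exact: expels_infty_swap.
- rewrite (_ : (fun z => - - _) = fun z => F (swap R *m z)); last first.
    by apply/funext => z; rewrite opprK.
  by split; exact: expels_o_swap.
Qed.

End Schottky.

(** * Real inequalities *)

Section RealInequalities.
Variable R : realType.
Implicit Types (u d p a b c r s v x y : R).

Lemma cos3 u : cos (3 * u) = 4 * cos u ^+ 3 - 3 * cos u.
Proof.
have -> : 3 * u = u *+ 2 + u by ring.
rewrite cosD cos_mulr2n sin_mulr2n -[cos u ^+ 2]/(cos u ^+ 2).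
have := sin2cos2 u; move: (cos u) (sin u) => c s hs.
transitivity ((c ^+ 2 *+ 2 - 1) * c - 2 * c * s ^+ 2); first by ring.
by rewrite hs; ring.
Qed.

Lemma sin3 u : sin (3 * u) = 3 * sin u - 4 * sin u ^+ 3.
Proof.
have -> : 3 * u = u *+ 2 + u by ring.
rewrite sinD cos_mulr2n sin_mulr2n.
have := cos2sin2 u; move: (cos u) (sin u) => c s hs.
transitivity (2 * c ^+ 2 * s + (2 * c ^+ 2 - 1) * s); first by ring.
by rewrite hs; ring.
Qed.

(** The triple angle formula makes the value a positive root of
    [4 c^3 - 3 c + 1 = (c + 1) (2 c - 1)^2]. *)
Lemma cos_pi_div3 : cos (pi / 3) = 2^-1 :> R.
Proof.
have p0 := pi_gt0 R.
have c0 : 0 < cos (pi / 3 : R) by apply: cos_gt0_pihalf; lra.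
have : cos (3 * (pi / 3)) = -1 :> R.
  by rewrite -cospi; congr cos; field.
rewrite cos3; move: (cos _) c0 => c c0 h.
have : (c + 1) * (2 * c - 1) ^+ 2 = 0 
  by transitivity (4 * c ^+ 3 - 3 * c + 1); [ring | rewrite h; ring].
by move/eqP; rewrite mulf_eq0 sqrf_eq0 => /orP[] /eqP; lra.
Qed.

(* Writing [p = cos y], [q = sin y], the claim is
   [cos y * (1 + cos (y + 3u)) <= 2 cos^3 u]. *)
Lemma cos_mul_le u p q : 2^-1 <= cos u -> p ^+ 2 + q ^+ 2 = 1 ->
  p * (1 + (p * cos (3 * u) - q * sin (3 * u))) <= 2 * cos u ^+ 3.
Proof.
rewrite cos3 sin3; have := cos2Dsin2 u; move: (cos u) (sin u) => c s cs c2 pq.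
(* [P] and [Q] are the cosine and sine of [y + u]. The deficit then factors as [1 - P] times
   [cos (y + 2u) + 2 cos u], and the last factor is nonnegative because [cos u] is at least 1/2. *)
pose P := p * c - q * s; pose Q := p * s + q * c.
have PQ : P ^+ 2 + Q ^+ 2 = 1.
  transitivity ((p ^+ 2 + q ^+ 2) * (c ^+ 2 + s ^+ 2)).
    by rewrite /P /Q; ring.
  by rewrite cs pq mulr1.
have pE : p = P * c + Q * s.
  by rewrite -[LHS]mulr1 -cs /P /Q; ring.
have aE : p * (4 * c ^+ 3 - 3 * c) - q * (3 * s - 4 * s ^+ 3)
    = P * (2 * c ^+ 2 - 1) - Q * (2 * s * c).
  rewrite /P /Q; have -> : 4 * c ^+ 3 - 3 * c = 4 * c ^+ 3 - 3 * c * (c ^+ 2 + s ^+ 2).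
    by rewrite cs mulr1.
  have -> : 3 * s - 4 * s ^+ 3 = 3 * s * (c ^+ 2 + s ^+ 2) - 4 * s ^+ 3.
    by rewrite cs mulr1.
  have -> : 2 * c ^+ 2 - 1 = 2 * c ^+ 2 - (c ^+ 2 + s ^+ 2) by rewrite cs.
  by ring.
have sE : s ^+ 2 = 1 - c ^+ 2 by lra.
have QE : Q ^+ 2 = 1 - P ^+ 2 by lra.
rewrite aE pE -subr_ge0.
have -> : 2 * c ^+ 3 - (P * c + Q * s) *
    (1 + (P * (2 * c ^+ 2 - 1) - Q * (2 * s * c))) =
    (1 - P) * (c * P - s * Q + 2 * c).
  transitivity (2 * c ^+ 3 - (P * c + Q * s)
      - (P ^+ 2 * c * (2 * c ^+ 2 - 1) - 2 * c * (s ^+ 2) * (Q ^+ 2))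
      - P * Q * s * (2 * c ^+ 2 - 1) + 2 * P * Q * s * c ^+ 2); first by ring.
  by rewrite sE QE; ring.
have P1 : P <= 1.
  by have : 0 <= Q ^+ 2 := sqr_ge0 Q; rewrite QE => ?; nra.
have : -1 <= c * P - s * Q.
  have : (c * P - s * Q) ^+ 2 <= 1.
    have -> : 1 = (c * P - s * Q) ^+ 2 + (c * Q + s * P) ^+ 2.
      by transitivity ((c ^+ 2 + s ^+ 2) * (P ^+ 2 + Q ^+ 2));
        [rewrite cs PQ mulr1|ring].
    by rewrite lerDl sqr_ge0.
  by move: (_ - _) => w; nra.
by move=> h; rewrite mulr_ge0 //; lra.
Qed.

Lemma le_norm_pair (K p a : R) : p * (1 + a) <= K -> - p * (1 - a) <= K ->
  p * (1 - a) <= K -> - p * (1 + a) <= K -> `|p| * (1 + `|a|) <= K.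
Proof.
have [p0|p0] := lerP 0 p; have [a0|a0] := lerP 0 a => //;
by rewrite ?(ger0_norm p0) ?(ltr0_norm p0) ?(ger0_norm a0) ?(ltr0_norm a0).
Qed.

(** For [d >= 0] the second angle is [u = d / 3 - pi / 3]: tripling it gives [d - pi], which
    reverses both signs, and [d / 3 <= - u <= pi / 3]. Negative [d] follows by symmetry. *)
Lemma cos_div3 d : - (pi / 2) <= d <= pi / 2 ->
  2^-1 <= cos (d / 3) /\ exists u, 
    [/\ 2^-1 <= cos u, cos u <= cos (d / 3),
        cos (3 * u) = - cos d & sin (3 * u) = - sin d].
Proof.
move=> /andP[d1 d2]; have p0 := pi_gt0 R.
wlog d0 : d d1 d2 / 0 <= d.
  move=> H; have [/H|dlt0] := lerP 0 d; first exact.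
  have [|||c2 [u [u2 ud cu su]]] := H (- d); [lra|lra|lra|].
  rewrite mulNr cosN in c2 ud; split=> //; exists (- u).
  by split; rewrite ?mulrN ?cosN ?sinN ?cu ?su ?cosN ?sinN ?opprK.
have dec x y : 0 <= x -> x <= y -> y <= pi -> cos y <= cos x.
  move=> x0; rewrite le_eqVlt => /orP[/eqP -> //|xy] yp; apply/ltW.
  by rewrite ltr_cos // in_itv /=; apply/andP; split; lra.
split.
  by rewrite -cos_pi_div3; apply: dec; lra.
exists (d / 3 - pi / 3); split.
- by rewrite -cosN -cos_pi_div3; apply: dec; lra.
- by rewrite -cosN; apply: dec; lra.
- have -> : 3 * (d / 3 - pi / 3) = d - pi by field.
  by rewrite cosB cospi sinpi; ring.
- have -> : 3 * (d / 3 - pi / 3) = d - pi by field.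
  by rewrite sinB cospi sinpi; ring.
Qed.

(** The absolute values open into four sign patterns, obtained from [cos_mul_le] at [(p, q)] and
    [(- p, - q)]: with the angle [d / 3] when the two signs agree, with the second angle of
    [cos_div3] when they differ. *)
Lemma cos_div3_bound d p q : - (pi / 2) <= d <= pi / 2 ->
  p ^+ 2 + q ^+ 2 = 1 ->
  `|p| * (1 + `|p * cos d - q * sin d|) <= 2 * cos (d / 3) ^+ 3.
Proof.
move=> /cos_div3[c2 [u [u2 uc cu su]]] pq.
have pqN : (- p) ^+ 2 + (- q) ^+ 2 = 1 by rewrite !sqrrN.
have dE : d = 3 * (d / 3) by field.
have h1 := cos_mul_le c2 pq; have h2 := cos_mul_le c2 pqN.
have h3 := cos_mul_le u2 pq; have h4 := cos_mul_le u2 pqN.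
rewrite -dE in h1 h2; rewrite cu su in h3 h4.
have c3 : 2 * cos u ^+ 3 <= 2 * cos (d / 3) ^+ 3.
  by rewrite ler_pM2l // lerXn2r // nnegrE; lra.
have le_eq (x y z : R) : y <= z -> x = y -> x <= z by move=> ? ->.
apply: le_norm_pair.
- exact: h1.
- by apply: le_eq h2 _; ring.
- by apply: le_eq (le_trans h3 c3) _; ring.
- by apply: le_eq (le_trans h4 c3) _; ring.
Qed.

Lemma amgm_sqr (al be B r v : R) : 0 <= al -> 0 <= be -> B ^+ 2 = al * be ->
  0 <= r -> 0 <= v -> 0 <= B -> 2 * r * v * B <= r ^+ 2 * al + v ^+ 2 * be.
Proof.
move=> al0 be0 hB r0 v0 B0.
have h0 : 0 <= r ^+ 2 * al + v ^+ 2 * be by rewrite addr_ge0 // mulr_ge0 // sqr_ge0.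
rewrite -(@ler_pXn2r _ 2) // ?nnegrE ?mulr_ge0 // -subr_ge0.
have -> : (r ^+ 2 * al + v ^+ 2 * be) ^+ 2 - (2 * r * v * B) ^+ 2 =
    (r ^+ 2 * al - v ^+ 2 * be) ^+ 2.
  transitivity ((r ^+ 2 * al + v ^+ 2 * be) ^+ 2 - 4 * r ^+ 2 * v ^+ 2 * B ^+ 2).
    by ring.
  by rewrite hB; ring.
exact: sqr_ge0.
Qed.

(** For a null vector with third coordinate 1, the factors on the left are the slab coordinates
    before and after [swap], and [r^2 + v^2] is the squared modulus of the first coordinate. With
    [rho^2 = 2 r], multiply by [rho + |A|]: [cos_div3_bound] controls [|x| * (rho + |A|)], and the
    arithmetic-geometric mean controls the rest since [B^2 = (rho - |A|) * (rho + |A|)]. *)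
Lemma slab_product d x y r v : - (pi / 2) <= d <= pi / 2 ->
  x ^+ 2 + y ^+ 2 = 2 * r ->
  `|x| * `|v * (x * sin d + y * cos d) - r * (x * cos d - y * sin d)| <=
  2 * cos (d / 3) ^+ 3 * (r ^+ 2 + v ^+ 2).
Proof.
move=> hd hr; set A := x * cos d - _; set B := x * sin d + _.
set K := cos (d / 3) ^+ 3.
have K0 : 0 < K by rewrite exprn_gt0 //; have [] := cos_div3 hd; lra.
have r0 : 0 <= r.
  by have := sqr_ge0 x; have := sqr_ge0 y; lra.
have [re0|rn0] := eqVneq r 0.
  have x0 : x = 0.
    apply/eqP; rewrite -sqrf_eq0; apply/eqP.
    by have := sqr_ge0 x; have := sqr_ge0 y; rewrite re0 in hr; lra.
  rewrite x0 normr0 mul0r mulr_ge0 ?addr_ge0 ?sqr_ge0 //.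
  by rewrite mulr_ge0 // ltW.
have rgt0 : 0 < r by rewrite lt_def rn0.
pose rho := Num.sqrt (2 * r).
have rho0 : 0 < rho by rewrite sqrtr_gt0 mulr_gt0.
have rho2 : rho ^+ 2 = 2 * r by rewrite sqr_sqrtr // mulr_ge0.
have AB : A ^+ 2 + B ^+ 2 = rho ^+ 2.
  rewrite rho2 -hr /A /B -[RHS]mulr1 -(cos2Dsin2 d); ring.
have xA : `|x| * (rho + `|A|) <= 2 * K * rho ^+ 2.
  have := @cos_div3_bound d (x / rho) (y / rho) hd.
  have -> : (x / rho) ^+ 2 + (y / rho) ^+ 2 = 1.
    by rewrite !expr_div_n -mulrDl hr rho2 divff // mulf_neq0.
  move=> /(_ erefl); rewrite -/K.
  have -> : x / rho * cos d - y / rho * sin d = A / rho.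
    by rewrite /A; field; rewrite gt_eqF.
  rewrite !normf_div (gtr0_norm rho0) => h.
  have := ler_wpM2r (ltW (exprn_gt0 2 rho0)) h; apply: le_trans.
  by rewrite le_eqVlt; apply/orP; left; apply/eqP; field; rewrite gt_eqF.
have A0 := normr_ge0 A; have B0 := normr_ge0 B; have v0 := normr_ge0 v.
have Arho : `|A| <= rho.
  rewrite -(@ler_pXn2r _ 2) // ?nnegrE ?(ltW rho0) //.
  by rewrite real_normK ?num_real // -AB lerDl sqr_ge0.
have amgm : 2 * r * `|v| * `|B| <= r ^+ 2 * (rho - `|A|) + v ^+ 2 * (rho + `|A|).
  rewrite -[v ^+ 2]real_normK ?num_real //; apply: amgm_sqr => //; first lra.
    by rewrite addr_ge0 // ltW.
  rewrite real_normK ?num_real // -subr_sqr real_normK ?num_real // -AB.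
  by ring.
have vB : `|v * B - r * A| <= `|v| * `|B| + r * `|A|.
  by rewrite (le_trans (ler_normB _ _)) // !normrM (ger0_norm r0).
have S0 : 0 < rho + `|A| by rewrite ltr_pwDl.
rewrite -(ler_pM2r S0).
apply: (@le_trans _ _ (2 * K * rho ^+ 2 * (`|v| * `|B| + r * `|A|))).
  rewrite mulrAC; apply: ler_pM => //; rewrite ?mulr_ge0 ?addr_ge0 //.
  exact: ltW.
rewrite rho2 -!(mulrA 2) ler_pM2l // -!(mulrA K) ler_pM2l //.
by rewrite -subr_ge0; move: amgm; rewrite -subr_ge0; congr (0 <= _); ring.
Qed.

(* [V = a + ib] is the second coordinate of a normalised null vector, and
   [Wr + i Wi] the third coordinate of its image under [heis_o]; the identity
   behind the bound is [|V - V0|^2 = -2 Re (W * conj p) / |p|^2] with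
   [p = - sigma^2 + i tau] and [V0 = - q * sigma * e2 * p / |p|^2]. *)
Lemma isometric_ball (q sg tau c1 d1 c2 d2 a b v M2 r Wr Wi : R) : q ^+ 2 = 2 ->
  c1 ^+ 2 + d1 ^+ 2 = 1 -> c2 ^+ 2 + d2 ^+ 2 = 1 ->
  0 < M2 -> M2 = sg ^+ 4 + tau ^+ 2 ->
  r = (a ^+ 2 + b ^+ 2) / 2 ->
  Wr = 1 - q * sg * (c2 * a + d2 * b) + (sg ^+ 2 * r - tau * v) ->
  Wi = - q * sg * (c2 * b - d2 * a) - (sg ^+ 2 * v + tau * r) ->
  ((c1 * a + d1 * b - q * sg * (sg ^+ 2 * (c1 * c2 + d1 * d2) +
      tau * (d2 * c1 - c2 * d1)) / M2) ^+ 2) ^+ 2 * M2 <=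
  4 * (Wr ^+ 2 + Wi ^+ 2).
Proof.
move=> q2 e1 e2 M0 ME rE WrE WiE.
(* [X + iY] is [V - V0]. Cauchy-Schwarz is then used twice: for its component along [(c1, d1)], and
   for the real part of [W * conj p]. *)
pose X := a + q * sg * (- c2 * sg ^+ 2 - d2 * tau) / M2.
pose Y := b + q * sg * (c2 * tau - d2 * sg ^+ 2) / M2.
have Mn : M2 != 0 by rewrite gt_eqF.
have XY : X ^+ 2 + Y ^+ 2 = 2 * (Wr * sg ^+ 2 - Wi * tau) / M2.
  transitivity (2 * r + 2 * q * sg / M2 * (a * (- c2 * sg ^+ 2 - d2 * tau) +
      b * (c2 * tau - d2 * sg ^+ 2)) +
      q ^+ 2 * sg ^+ 2 * ((c2 ^+ 2 + d2 ^+ 2) * (sg ^+ 4 + tau ^+ 2)) / M2 ^+ 2).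
    by rewrite /X /Y rE; field.
  rewrite q2 e2 -ME mul1r WrE WiE.
  have -> : 2 * r = 2 * r * (sg ^+ 4 + tau ^+ 2) / M2 by rewrite -ME; field.
  by field.
have -> : c1 * a + d1 * b - q * sg * (sg ^+ 2 * (c1 * c2 + d1 * d2) +
    tau * (d2 * c1 - c2 * d1)) / M2 = c1 * X + d1 * Y.
  by rewrite /X /Y; field.
have T2 : (c1 * X + d1 * Y) ^+ 2 <= X ^+ 2 + Y ^+ 2.
  rewrite -subr_ge0 (_ : _ - _ = (c1 * Y - d1 * X) ^+ 2) ?sqr_ge0 //.
  by rewrite -[X ^+ 2 + Y ^+ 2]mul1r -e1; ring.
apply: (@le_trans _ _ ((X ^+ 2 + Y ^+ 2) ^+ 2 * M2)).
  by rewrite ler_pM2r // lerXn2r // nnegrE ?addr_ge0 ?sqr_ge0.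
rewrite XY.
have -> : (2 * (Wr * sg ^+ 2 - Wi * tau) / M2) ^+ 2 * M2 =
    4 * ((Wr * sg ^+ 2 - Wi * tau) ^+ 2 / M2) by field.
rewrite ler_pM2l // ler_pdivrMr // ME -subr_ge0.
rewrite (_ : _ - _ = (Wr * tau + Wi * sg ^+ 2) ^+ 2) ?sqr_ge0 //.
by ring.
Qed.

(* The quartic in [w] is minimal at [w0 = k * (X - Y)], by Cardano's formula. *)
Lemma cygan_quartic_min (w s t X Y k : R) :
  k ^+ 3 = s -> k ^+ 4 = X * Y -> t = (X ^+ 3 - Y ^+ 3) / 2 ->
  (X ^+ 2 - X * Y + Y ^+ 2) ^+ 3 <=
  w ^+ 4 + 6 * s ^+ 2 * w ^+ 2 - 8 * t * s * w + s ^+ 4 + 4 * t ^+ 2.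
Proof.
move=> ks kXY tE; pose w0 := k * (X - Y).
have h0 : w0 ^+ 4 + 6 * s ^+ 2 * w0 ^+ 2 - 8 * t * s * w0 + s ^+ 4 + 4 * t ^+ 2
    = (X ^+ 2 - X * Y + Y ^+ 2) ^+ 3.
  transitivity (k ^+ 4 * (X - Y) ^+ 4 + 6 * (k ^+ 4) ^+ 2 * (X - Y) ^+ 2
    - 8 * t * k ^+ 4 * (X - Y) + (k ^+ 4) ^+ 3 + 4 * t ^+ 2).
    by rewrite /w0 -ks; ring.
  by rewrite kXY tE; field.
have h1 : 4 * w0 ^+ 3 + 12 * s ^+ 2 * w0 - 8 * t * s = 0.
  transitivity (k ^+ 3 * (4 * (X - Y) ^+ 3 + 12 * k ^+ 4 * (X - Y) - 8 * t)).
    by rewrite /w0 -ks; ring.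
  by rewrite kXY tE; field.
rewrite -h0 -subr_ge0.
(* Expansion at [w0]: the linear coefficient is the derivative there, which vanishes by [h1], and
   the remainder is a square times a sum of squares. *)
have -> : w ^+ 4 + 6 * s ^+ 2 * w ^+ 2 - 8 * t * s * w + s ^+ 4 + 4 * t ^+ 2 -
    (w0 ^+ 4 + 6 * s ^+ 2 * w0 ^+ 2 - 8 * t * s * w0 + s ^+ 4 + 4 * t ^+ 2) =
    (w - w0) ^+ 2 * ((w + w0) ^+ 2 + 2 * w0 ^+ 2 + 6 * s ^+ 2) +
    (4 * w0 ^+ 3 + 12 * s ^+ 2 * w0 - 8 * t * s) * (w - w0) by ring.
rewrite h1 mul0r addr0; apply: mulr_ge0; first exact: sqr_ge0.
by have := sqr_ge0 (w + w0); have := sqr_ge0 w0; have := sqr_ge0 s; lra.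
Qed.

End RealInequalities.

(** * Slabs *)

Section Slabs.
Local Open Scope complex_scope.
Variable R : realType.
Implicit Types (s th t w c : R) (z : 'cV[R[i]]_3).
Local Notation q := (Num.sqrt (2 : R)).

Let q2 : q ^+ 2 = 2. Proof. by rewrite sqr_sqrtr. Qed.
Let q0 : 0 < q. Proof. by rewrite sqrtr_gt0. Qed.

(* The real part of [conj (expi th) * z2 * conj z3]. *)
Definition slab_coord th z : R :=
  cos th * (re z@2 * re z@3 + im z@2 * im z@3)
  + sin th * (im z@2 * re z@3 - re z@2 * im z@3).

(* Positive exactly on an open slab of the Heisenberg group orthogonal to the
   direction [th], with centre [c] and half-width [w] in the coordinate
   [z2 / z3 = sqrt 2 * zeta]. *)
Definition slab th w c z : R := w * nsq z@3 - `|slab_coord th z - c * nsq z@3|.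

Lemma slab_coord_infty s th t z :
  slab_coord th (heis_infty s th t *m z) = slab_coord th z + q * s * nsq z@3.
Proof.
rewrite /slab_coord heis_infty2 heis_infty3 /nsq /expi.
have := cos2Dsin2 th; move: (cos th) (sin th) => a b ab.
case: z@2 z@3 => [x y] [u v] /=.
rewrite -[X in _ = _ + X]mul1r -ab; ring.
Qed.

(** Each application shifts the coordinate by a full width [2 w] in one direction. A point at
    distance less than [w] from the centre thus ends, under every positive power, at distance more
    than [w]. *)
Lemma slab_expels s th t w c : 2 * w = `|q * s| -> 
  expels (heis_infty s th t) (slab th w c).
Proof.
move=> hw n z _; rewrite /slab heis_inftyX3.
have -> : slab_coord th (heis_infty s th t ^+ n.+1 *m z) =
    slab_coord th z + n.+1%:R * (q * s * nsq z@3).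
  elim: n.+1 => [|k IH]; first by rewrite expr0 mul1mx mul0r addr0.
  by rewrite mulmxXS slab_coord_infty heis_inftyX3 IH -natr1; ring.
move: (slab_coord th z) (nsq_ge0 z@3) => x; move: (nsq _) => D D0.
set e := x - c * D => he.
have -> : x + n.+1%:R * (q * s * D) - c * D = e + n.+1%:R * (q * s * D).
  by rewrite /e; ring.
have wD0 : 0 < w * D by have := normr_ge0 e; lra.
have : `|n.+1%:R * (q * s * D)| - `|e| <= `|e + n.+1%:R * (q * s * D)|.
  by rewrite [X in _ <= `|X|]addrC; exact: lerB_normD.
rewrite normrM normrM -hw (ger0_norm D0) ger0_norm //.
have : 1 * (2 * w * D) <= n.+1%:R * (2 * w * D).
  by apply: ler_wpM2r; [lra | rewrite ler1n].
by lra.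
Qed.

Lemma slab_continuous th w c : orbit_continuous (slab th w c).
Proof.
have cst k := @orbit_continuous_cst R k.
have nsq_c := @orbit_continuous_nsq R (1 + 1).
have re_c i := @orbit_continuous_re R i; have im_c i := @orbit_continuous_im R i.
have M := @orbit_continuousM R; have D := @orbit_continuousD R.
have B := @orbit_continuousB R.
apply: (B); first exact: M.
apply: orbit_continuous_norm; apply: (B); last exact: M.
apply: (D); apply: (M) => //; [apply: (D)|apply: (B)]; exact: M.
Qed.

(** The standard null lift of the Heisenberg point [(zeta, v)] with [sqrt 2 * zeta = a + ib]. *)
Definition hvec (a b v : R) : 'cV[R[i]]_3 :=
  \col_k nth 0 [:: (- (a ^+ 2 + b ^+ 2) / 2) +i* v; a +i* b; 1] k.

Lemma hvec_isotropic a b v : isotropic (hvec a b v).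
Proof.
split.
  by apply/eqP => /colP /(_ (1 + 1)); rewrite !mxE /= => /eqP; rewrite oner_eq0.
rewrite hermE !mxE /=; apply/eqP; rewrite eq_complex /=.
by apply/andP; split; apply/eqP; field.
Qed.

Lemma hvecP z : isotropic z -> z@3 != 0 -> exists a b v,
  z@1 = z@3 * (hvec a b v)@1 /\ z@2 = z@3 * (hvec a b v)@2.
Proof.
move=> /isotropicE hz z30.
exists (re (z@2 / z@3)), (im (z@2 / z@3)), (im (z@1 / z@3)).
have z1 : z@1 = z@3 * (z@1 / z@3) by rewrite mulrCA divff ?mulr1.
have z2 : z@2 = z@3 * (z@2 / z@3) by rewrite mulrCA divff ?mulr1.
rewrite !mxE /=; split; last by rewrite {1}z2; case: (_ / _).
rewrite {1}z1; congr (_ * _).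
have := nsq_gt0 z@3; rewrite z30 => N0.
rewrite z2 z1 in hz.
move: (z@1 / z@3) (z@2 / z@3) hz N0 => [u v] [a b].
case: z@3 => [x y]; rewrite /nsq /= => hz N0.
congr (_ +i* _).
have : (x ^+ 2 + y ^+ 2) * (a ^+ 2 + b ^+ 2 + 2 * u) = 0.
  rewrite -[RHS](subrr (- 2 * ((x * u - y * v) * x + (x * v + y * u) * y))).
  by rewrite -{1}hz; ring.
by move/eqP; rewrite mulf_eq0 gt_eqF //= => /eqP; lra.
Qed.

End Slabs.

(** * A slab containing two isometric balls *)

Section SlabCases.
Local Open Scope complex_scope.
Variable R : realType.
Implicit Types (s th t w c : R) (z : 'cV[R[i]]_3).
Local Notation q := (Num.sqrt (2 : R)).

Let q2 : q ^+ 2 = 2. Proof. by rewrite sqr_sqrtr. Qed.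
Let q0 : 0 < q. Proof. by rewrite sqrtr_gt0. Qed.

Lemma slab_gt0_ex th w c : 0 < w -> exists2 z, isotropic z & 0 < slab th w c z.
Proof.
move=> w0; exists (hvec (c * cos th) (c * sin th) 0); first exact: hvec_isotropic.
rewrite /slab /slab_coord /nsq !mxE /=.
rewrite [X in `|X|](_ : _ = c * (cos th ^+ 2 + sin th ^+ 2 - 1)); last by ring.
by rewrite cos2Dsin2 subrr mulr0 normr0; lra.
Qed.

Lemma heis_oX3 s th t n z :
  (heis_o s th t ^+ n *m z)@3 = (heis_infty s th t ^+ n *m (swap R *m z))@1.
Proof. by rewrite (heis_oX s th t n) swap3. Qed.

Lemma heis_o3 s th t z :
  (heis_o s th t *m z)@3 = (heis_infty s th t *m (swap R *m z))@1.
Proof. by rewrite (heis_oE s th t z) swap3. Qed.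

Lemma heis_oK s th t z : heis_o (- s) th (- t) *m (heis_o s th t *m z) = z.
Proof.
rewrite (heis_oE (- s) th (- t)) (heis_oE s th t z) swapK.
by rewrite heis_inftyK swapK.
Qed.

(* [nsq (B z)_3 <= nsq z_3] describes the isometric ball of [B]. *)
Lemma heis_o_expels s th t (F : 'cV[R[i]]_3 -> R) :
  (forall z, isotropic z -> F z < 0 -> nsq z@3 < nsq (heis_o s th t *m z)@3) ->
  (forall z, isotropic z ->
    nsq (heis_o (- s) th (- t) *m z)@3 < nsq z@3 -> 0 < F z) ->
  expels (heis_o s th t) (fun z => - F z).
Proof.
move=> out ball n z zi; rewrite oppr_gt0 oppr_lt0 => /(out z zi) h.
pose u k := nsq (heis_o s th t ^+ k *m z)@3.
have cu k : 2 * u k.+1 <= u k + u k.+2.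
  by rewrite /u !heis_oX3; exact/heis_inftyX_convex/isotropic_swap.
have u01 : u 0 < u 1 by rewrite /u expr0 expr1 mul1mx.
apply: ball.
  by apply: SU21_isotropic zi; apply: SU21X; exact: heis_o_SU21.
(* Applying the inverse to the last point leads back to index [n]. The goal becomes [u n < u n.+1],
   which convexity propagates from [u 0 < u 1]. *)
rewrite (mulmxXS (heis_o s th t)) heis_oK -mulmxXS -/(u n) -/(u n.+1).
by have := convex_seq_le cu (ltW u01) n; lra.
Qed.

Lemma heis_o_hvec3 s th t z a b v :
  z@1 = z@3 * (hvec a b v)@1 -> z@2 = z@3 * (hvec a b v)@2 ->
  let r := (a ^+ 2 + b ^+ 2) / 2 in
  nsq (heis_o s th t *m z)@3 = nsq z@3 *
   ((1 - q * s * (cos th * a + sin th * b) + (s ^+ 2 * r - t * v)) ^+ 2 +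
    (- q * s * (cos th * b - sin th * a) - (s ^+ 2 * v + t * r)) ^+ 2).
Proof.
move=> z1 z2 /=; rewrite heis_o3 heis_infty1 swap1 swap2 swap3 z1 z2.
set k := z@3; rewrite [X in nsq X](_ : _ = k *
    (1 - (q * s)%:C * expi (- th) * (hvec a b v)@2 +
     (- s ^+ 2 +i* t) * (hvec a b v)@1)); last by ring.
rewrite nsqM; congr (_ * _).
rewrite !mxE /= expiN /expi /nsq /=; by congr (_ ^+ 2 + _ ^+ 2); field.
Qed.

Lemma slab_coord_hvec th z a b v : z@2 = z@3 * (hvec a b v)@2 ->
  slab_coord th z = nsq z@3 * (cos th * a + sin th * b).
Proof.
move=> z2; rewrite /slab_coord z2 !mxE /nsq /=; case: z@3 => x y /=; ring.
Qed.

(** By [isometric_ball], the projection of the isometric ball to the direction [th1] lies within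
    [q / m] of the slab centre shifted by [q * s^3 * cos (th1 - th2) / m^4]. Under
    [(s, t) -> (- s, - t)] this shift is odd while the slab centre is even, so one slab serves a
    translation and its inverse. The boolean treats open and closed sets together. *)
Lemma isometric_ball_slab s1 th1 s2 th2 s t m z (strict : bool) :
  isotropic z -> z@3 != 0 -> 0 < m -> m ^+ 4 = s ^+ 4 + t ^+ 2 ->
  `|s ^+ 3 * cos (th1 - th2)| / m ^+ 4 + m^-1 <= s1 / 2 ->
  nsq (heis_o s th2 t *m z)@3 < nsq z@3 ?<= if ~~ strict ->
  0 < slab th1 (q * (s1 / 2)) (q * s * t * sin (th2 - th1) / m ^+ 4) z
    ?<= if ~~ strict.
Proof.
move=> zi z3 m0 m4 hs1.
have [a [b [v [z1 z2]]]] := hvecP zi z3.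
rewrite (heis_o_hvec3 _ _ _ z1 z2) /slab (slab_coord_hvec _ z2).
have := nsq_gt0 z@3; rewrite z3; move: (nsq _) => D D0.
set Wr := 1 - _ + _; set Wi := _ - (_ + _).
have := @isometric_ball R q s t (cos th1) (sin th1) (cos th2) (sin th2) a b v
  (m ^+ 4) _ Wr Wi q2 (cos2Dsin2 _) (cos2Dsin2 _) (exprn_gt0 4 m0) m4 erefl
  erefl erefl.
have -> : cos th1 * cos th2 + sin th1 * sin th2 = cos (th1 - th2).
  by rewrite cosB.
have -> : sin th2 * cos th1 - cos th2 * sin th1 = sin (th2 - th1).
  by rewrite sinB.
set C := cos (th1 - _); set S := sin (th2 - _).
set x := cos th1 * a + _; set T := x - _ => hT hW.
have mn : m != 0 by rewrite gt_eqF.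
have Tm : (`|T| * m) ^+ 4 <= 4 * (Wr ^+ 2 + Wi ^+ 2).
  apply: le_trans hT; rewrite exprMn -[(T ^+ 2) ^+ 2]exprM.
  by rewrite -normrX (ger0_norm (exprn_even_ge0 _ _)).
have q4 : q ^+ 4 = 4 by rewrite (exprM q 2 2) q2; ring.
have {Tm hW} Tq : `|T| * m < q ?<= if ~~ strict.
  have nn : 0 <= `|T| * m by rewrite mulr_ge0 // ltW.
  case: strict hW => /= hW.
    rewrite -(@ltr_pXn2r _ 4) ?nnegrE ?(ltW q0) //; apply: le_lt_trans Tm _.
    by rewrite q4; move: hW; rewrite -[ltRHS]mulr1 ltr_pM2l //; lra.
  rewrite -(@ler_pXn2r _ 4) ?nnegrE ?(ltW q0) //; apply: le_trans Tm _.
  by rewrite q4; move: hW; rewrite -[leRHS]mulr1 ler_pM2l //; lra.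
have -> : D * x - q * s * t * S / m ^+ 4 * D = D * (T + q * (s ^+ 3 * C / m ^+ 4)).
  by rewrite /T; field.
rewrite normrM (gtr0_norm D0) mulrC -mulrBr.
have nT : `|T + q * (s ^+ 3 * C / m ^+ 4)| <=
    `|T| + q * (`|s ^+ 3 * C| / m ^+ 4).
  rewrite (le_trans (ler_normD _ _)) // lerD2l normrM normf_div (gtr0_norm q0).
  by rewrite (gtr0_norm (exprn_gt0 _ m0)).
have hq := ler_wpM2l (ltW q0) hs1; rewrite mulrDr in hq.
case: strict Tq => /=.
  rewrite -ltr_pdivlMr // => Tq; rewrite pmulr_rgt0 //; lra.
rewrite -ler_pdivlMr // => Tq; rewrite pmulr_rge0 //; lra.
Qed.

Lemma schottky_slab_ball s1 th1 t1 s2 th2 t2 m :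
  0 < m -> m ^+ 4 = s2 ^+ 4 + t2 ^+ 2 ->
  `|s2 ^+ 3 * cos (th1 - th2)| / m ^+ 4 + m^-1 <= s1 / 2 ->
  schottky (heis_infty s1 th1 t1) (heis_o s2 th2 t2).
Proof.
move=> m0 m4 hs1; have m'0 : 0 < m^-1 by rewrite invr_gt0.
have : 0 <= `|s2 ^+ 3 * cos (th1 - th2)| / m ^+ 4.
  by rewrite divr_ge0 // ltW // exprn_gt0.
move=> h0; have s10 : 0 < s1 by lra.
pose c := q * s2 * t2 * sin (th2 - th1) / m ^+ 4.
exists (slab th1 (q * (s1 / 2)) c); split.
- exact: slab_continuous.
- by apply: slab_gt0_ex; rewrite mulr_gt0 // divr_gt0.
- rewrite heis_inftyV; split; apply: slab_expels.
    by rewrite gtr0_norm ?mulr_gt0 //; field.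
  by rewrite mulrN normrN gtr0_norm ?mulr_gt0 //; field.
(* The sign [(-1)^e] covers [B] and its inverse, and changes neither [c] nor the bound by
   [s1 / 2]. *)
have main e strict z : isotropic z -> z@3 != 0 ->
    nsq (heis_o ((-1) ^+ nat_of_bool e * s2) th2 ((-1) ^+ nat_of_bool e * t2) *m z)@3
      < nsq z@3 ?<= if ~~ strict ->
    0 < slab th1 (q * (s1 / 2)) c z ?<= if ~~ strict.
  move=> zi z3 /(@isometric_ball_slab s1 th1 s2) H.
  rewrite (_ : c = q * ((-1) ^+ e * s2) * ((-1) ^+ e * t2) *
    sin (th2 - th1) / m ^+ 4); last first.
    by rewrite /c; case: (e); rewrite ?expr0 ?expr1; ring.
  apply: H => //; first by rewrite m4; case: (e); rewrite ?expr0 ?expr1; ring.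
  apply: le_trans hs1; rewrite lerD2r ler_pM2r ?invr_gt0 ?exprn_gt0 //.
  by rewrite exprMn -mulrA normrM -exprM normrX normrN1 expr1n mul1r.
(* Contrapositive of the closed version. Where the third coordinate is 0 the function [slab]
   vanishes, so it is not negative there. *)
have out e z : isotropic z -> slab th1 (q * (s1 / 2)) c z < 0 -> nsq z@3 <
    nsq (heis_o ((-1) ^+ nat_of_bool e * s2) th2 ((-1) ^+ nat_of_bool e * t2) *m z)@3.
  move=> zi F0; rewrite ltNge; apply/negP => /(@main e false z zi) /= H.
  suff /H : z@3 != 0 by rewrite leNgt F0.
  apply: contraTneq F0 => z3; rewrite /slab /slab_coord z3 /nsq /=.
  by rewrite -leNgt !(mulr0, expr0n, addr0, subrr, normr0).
have ball e z : isotropic z -> 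
    nsq (heis_o ((-1) ^+ nat_of_bool e * s2) th2 ((-1) ^+ nat_of_bool e * t2) *m z)@3
    < nsq z@3 -> 0 < slab th1 (q * (s1 / 2)) c z.
  move=> zi Hz; apply: (@main e true) => //.
  by rewrite -nsq_gt0; apply: le_lt_trans (nsq_ge0 _) Hz.
have o0 := out false; have o1 := out true; have b0 := ball false.
have b1 := ball true; rewrite !expr0 !mul1r in o0 b0.
rewrite !expr1 !mulN1r in o1 b1.
rewrite heis_oV; split; apply: heis_o_expels => //.
by rewrite !opprK.
Qed.

End SlabCases.

(** * Two slabs related by the inversion *)

Section TwoSlabs.
Local Open Scope complex_scope.
Variable R : realType.
Implicit Types (s th t w c : R) (z : 'cV[R[i]]_3).
Local Notation q := (Num.sqrt (2 : R)).

Let q2 : q ^+ 2 = 2. Proof. by rewrite sqr_sqrtr. Qed.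
Let q0 : 0 < q. Proof. by rewrite sqrtr_gt0. Qed.

(** Homogeneous form of [slab_product]: [x] and [y] are the components of [z2 / z3] along and across
    the direction [th1]. *)
Lemma slab_coord_product th1 th2 z : isotropic z -> z@3 != 0 ->
  - (pi / 2) <= th1 - th2 <= pi / 2 ->
  `|slab_coord th1 z| * `|slab_coord th2 (swap R *m z)| <=
  2 * cos ((th1 - th2) / 3) ^+ 3 * nsq z@1 * nsq z@3.
Proof.
move=> zi z3 hd; have [a [b [v [z1 z2]]]] := hvecP zi z3.
rewrite (slab_coord_hvec _ z2).
pose x := cos th1 * a + sin th1 * b; pose y := cos th1 * b - sin th1 * a.
pose r := (a ^+ 2 + b ^+ 2) / 2.
have xy : x ^+ 2 + y ^+ 2 = 2 * r.
  transitivity ((a ^+ 2 + b ^+ 2) * (cos th1 ^+ 2 + sin th1 ^+ 2)).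
    by rewrite /x /y; ring.
  by rewrite cos2Dsin2 /r; field.
have := slab_product v hd xy.
set d := th1 - th2.
have -> : x * sin d + y * cos d = cos th2 * b - sin th2 * a.
  rewrite /d /x /y sinB cosB -[cos th2 * b]mul1r -[sin th2 * a]mul1r.
  by rewrite -(cos2Dsin2 th1); ring.
have -> : x * cos d - y * sin d = cos th2 * a + sin th2 * b.
  rewrite /d /x /y sinB cosB -[cos th2 * a]mul1r -[sin th2 * b]mul1r.
  by rewrite -(cos2Dsin2 th1); ring.
have -> : slab_coord th2 (swap R *m z) = nsq z@3 *
    (v * (cos th2 * b - sin th2 * a) - r * (cos th2 * a + sin th2 * b)).
  rewrite /slab_coord swap2 swap3 z1 z2 !mxE /r /nsq /=.
  by case: z@3 => k l /=; field.
have -> : nsq z@1 = nsq z@3 * (r ^+ 2 + v ^+ 2).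
  by rewrite z1 nsqM !mxE /r {2}/nsq /=; congr (_ * _); field.
rewrite !normrM (ger0_norm (nsq_ge0 z@3)) -/x => h.
have := ler_wpM2l (exprn_ge0 2 (nsq_ge0 z@3)) h.
by congr (_ <= _); ring.
Qed.

Lemma slab_coord_neq0 th z : slab_coord th z != 0 -> z@2 != 0 /\ z@3 != 0.
Proof.
move=> h; split; apply: contra h => /eqP e; apply/eqP;
by rewrite /slab_coord e /=; ring.
Qed.

Lemma isotropic_neq0 z : isotropic z -> z@2 != 0 -> z@1 != 0 /\ z@3 != 0.
Proof.
move=> /isotropicE e; rewrite -nsq_gt0 e => h.
by split; apply: contraTneq h => ->; rewrite /= -leNgt; lra.
Qed.

(** Outside both open slabs, and strictly outside one of their closures, the product of the two slab
    coordinates would exceed the bound of [slab_coord_product]. *)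
Lemma slab_slab_disj th1 th2 w1 w2 z : isotropic z -> 0 < w1 -> 0 < w2 ->
  - (pi / 2) <= th1 - th2 <= pi / 2 ->
  2 * cos ((th1 - th2) / 3) ^+ 3 <= w1 * w2 ->
  slab th1 w1 0 z < 0 \/ slab th2 w2 0 (swap R *m z) < 0 ->
  [\/ 0 < slab th1 w1 0 z | 0 < slab th2 w2 0 (swap R *m z)].
Proof.
move=> zi w10 w20 hd hw; rewrite /slab !mul0r !subr0 swap3 !subr_lt0 !subr_gt0.
move=> H.
have z2 : z@2 != 0.
  have n1 := nsq_ge0 z@1; have n3 := nsq_ge0 z@3.
  case: H => H.
    apply: (proj1 (@slab_coord_neq0 th1 z _)); rewrite -normr_gt0.
    by apply: le_lt_trans H; rewrite mulr_ge0 // ltW.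
  rewrite -swap2; apply: (proj1 (@slab_coord_neq0 th2 (swap R *m z) _)).
  rewrite -normr_gt0; apply: le_lt_trans H; rewrite mulr_ge0 // ltW //.
have [z1 z3] := isotropic_neq0 zi z2.
have := slab_coord_product zi z3 hd.
move: z1 z3 H; rewrite -!nsq_gt0.
move: (nsq z@1) (nsq z@3) => D1 D3 D10 D30 H.
have X := normr_ge0 (slab_coord th1 z).
have Y := normr_ge0 (slab_coord th2 (swap R *m z)).
move: X Y H; set x := `|slab_coord th1 z|.
set y := `|slab_coord th2 _| => x0 y0 H hxy.
have [xw|xw] := ltrP x (w1 * D3); first by left.
have [yw|yw] := ltrP y (w2 * D1); first by right.
have le1 : x * y <= w1 * w2 * D1 * D3.
  by apply: le_trans hxy _; rewrite !ler_pM2r.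
have a0 : 0 < w1 * D3 by rewrite mulr_gt0.
have b0 : 0 < w2 * D1 by rewrite mulr_gt0.
have lt1 : (w1 * D3) * (w2 * D1) < x * y.
  case: H => H.
    apply: (@lt_le_trans _ _ (x * (w2 * D1))); first by rewrite ltr_pM2r.
    exact: ler_wpM2l.
  apply: (@le_lt_trans _ _ (x * (w2 * D1))); first by rewrite ler_pM2r.
  by rewrite ltr_pM2l // (lt_le_trans a0).
have e : w1 * w2 * D1 * D3 = (w1 * D3) * (w2 * D1) by ring.
by move: le1; rewrite e leNgt lt1.
Qed.

(** A point outside the closed slab of [A] lies in the slab of [B]; powers of [B] move it strictly
    outside that slab, hence into the slab of [A], by two uses of [slab_slab_disj]. *)
Lemma schottky_slab_slab s1 th1 t1 s2 th2 t2 : 0 < s1 -> 0 < s2 ->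
  - (pi / 2) <= th1 - th2 <= pi / 2 ->
  4 * cos ((th1 - th2) / 3) ^+ 3 <= s1 * s2 ->
  schottky (heis_infty s1 th1 t1) (heis_o s2 th2 t2).
Proof.
move=> s10 s20 hd hs; exists (slab th1 (q * (s1 / 2)) 0).
have w10 : 0 < q * (s1 / 2) by rewrite mulr_gt0 // divr_gt0.
have w20 : 0 < q * (s2 / 2) by rewrite mulr_gt0 // divr_gt0.
have hw : 2 * cos ((th1 - th2) / 3) ^+ 3 <= q * (s1 / 2) * (q * (s2 / 2)).
  have -> : q * (s1 / 2) * (q * (s2 / 2)) = q ^+ 2 * (s1 * s2) / 4 by field.
  by rewrite q2; lra.
split.
- exact: slab_continuous.
- exact: slab_gt0_ex.
- rewrite heis_inftyV; split; apply: slab_expels.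
    by rewrite gtr0_norm ?mulr_gt0 //; field.
  by rewrite mulrN normrN gtr0_norm ?mulr_gt0 //; field.
have main s t : 2 * (q * (s2 / 2)) = `|q * s| ->
    expels (heis_o s th2 t) (fun z => - slab th1 (q * (s1 / 2)) 0 z).
  move=> hq n z zi; rewrite oppr_gt0 oppr_lt0 => F0.
  have swap_pos : 0 < slab th2 (q * (s2 / 2)) 0 (swap R *m z).
    have [F1|//] := slab_slab_disj zi w10 w20 hd hw (or_introl F0).
    by move: F0; rewrite ltNge (ltW F1).
  have := @slab_expels R s th2 t _ 0 hq n _ (isotropic_swap zi) swap_pos.
  rewrite -[heis_infty _ _ _ ^+ _ *m _]swapK.
  rewrite -(heis_oX s th2 t n.+1) => neg.
  have wi : isotropic (heis_o s th2 t ^+ n.+1 *m z).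
    by apply: SU21_isotropic zi; apply: SU21X; exact: heis_o_SU21.
  have [//|F1] := slab_slab_disj wi w10 w20 hd hw (or_intror neg).
  by move: neg; rewrite ltNge (ltW F1).
rewrite heis_oV; split; apply: main.
  by rewrite gtr0_norm ?mulr_gt0 //; field.
by rewrite mulrN normrN gtr0_norm ?mulr_gt0 //; field.
Qed.

End TwoSlabs.

(** * Cygan balls *)

Section CyganBalls.
Local Open Scope complex_scope.
Variable R : realType.
Implicit Types (s th t w k : R) (z : 'cV[R[i]]_3).
Local Notation q := (Num.sqrt (2 : R)).

Let q2 : q ^+ 2 = 2. Proof. by rewrite sqr_sqrtr. Qed.

(* If [z1 / z3] and its image both had squared modulus at most [k], so would
   the midpoint of the first and the conjugate of the second; its modulus is
   bounded below by a function of [w = sqrt 2 * y] alone, where [y] is the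
   component of [z2 / z3] orthogonal to the translation. *)
Lemma ball_disjoint_image s th t k z :
  (forall w, 16 * k <= (w ^+ 2 + s ^+ 2) ^+ 2 + 4 * (s * w - t) ^+ 2) ->
  isotropic z -> nsq z@1 < k * nsq z@3 ->
  k * nsq z@3 < nsq (heis_infty s th t *m z)@1.
Proof.
move=> hk zi hz; have [z3|z3] := eqVneq z@3 0.
  by move: hz; rewrite z3 {2}/nsq /= expr0n addr0 mulr0 ltNge nsq_ge0.
have [a [b [v [z1 z2]]]] := hvecP zi z3.
pose x := cos th * a + sin th * b; pose y := cos th * b - sin th * a.
pose r := (a ^+ 2 + b ^+ 2) / 2.
have xy : x ^+ 2 + y ^+ 2 = 2 * r.
  transitivity ((a ^+ 2 + b ^+ 2) * (cos th ^+ 2 + sin th ^+ 2)).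
    by rewrite /x /y; ring.
  by rewrite cos2Dsin2 /r; field.
have n1 : nsq z@1 = nsq z@3 * (r ^+ 2 + v ^+ 2).
  by rewrite z1 nsqM !mxE /r {2}/nsq /=; congr (_ * _); field.
have n2 : nsq (heis_infty s th t *m z)@1 = nsq z@3 *
    ((r + q * s * x + s ^+ 2) ^+ 2 + (v - q * s * y + t) ^+ 2).
  rewrite heis_infty1 z1 z2 [X in nsq X](_ : _ = z@3 *
    ((hvec a b v)@1 - (q * s)%:C * expi (- th) * (hvec a b v)@2 +
     (- s ^+ 2 +i* t))); last by ring.
  rewrite nsqM !mxE expiN /r /x /y {2}/nsq /expi /=; congr (_ * _).
  by field.
have := nsq_gt0 z@3; rewrite z3 => D0.
move: hz; rewrite n1 n2 ![nsq z@3 * _]mulrC !(ltr_pM2r D0) => h1.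
rewrite ltNge; apply/negP => h2.
have := hk (q * y).
have -> : ((q * y) ^+ 2 + s ^+ 2) ^+ 2 = 4 * (y ^+ 2 + s ^+ 2 / 2) ^+ 2.
  by rewrite exprMn q2; field.
set A := y ^+ 2 + s ^+ 2 / 2; set B := s * (q * y) - t.
have A0 : 0 <= A by rewrite addr_ge0 ?divr_ge0 ?sqr_ge0.
(* The dependence on [x] is removed by completing the square; equality holds at
   [x = - q * s / 2]. *)
have AC : A <= 2 * r + q * s * x + s ^+ 2.
  rewrite -xy /A -subr_ge0 (_ : _ - _ = (x + q * s / 2) ^+ 2) ?sqr_ge0 //.
  transitivity (x ^+ 2 + q * s * x + q ^+ 2 * s ^+ 2 / 4); last by field.
  by rewrite q2; field.
have A2 : A ^+ 2 <= (2 * r + q * s * x + s ^+ 2) ^+ 2.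
  by rewrite lerXn2r // nnegrE // (le_trans A0 AC).
have S1 := sqr_ge0 (r - (r + q * s * x + s ^+ 2)).
have S2 := sqr_ge0 (v + (v - q * s * y + t)).
have par : (2 * r + q * s * x + s ^+ 2) ^+ 2 + B ^+ 2 =
  2 * (r ^+ 2 + v ^+ 2) +
  2 * ((r + q * s * x + s ^+ 2) ^+ 2 + (v - q * s * y + t) ^+ 2)
  - (r - (r + q * s * x + s ^+ 2)) ^+ 2 - (v + (v - q * s * y + t)) ^+ 2.
  by rewrite /B; ring.
by move: A2 S1 S2 par h1 h2; lra.
Qed.

(** For [k > 0], positive exactly on the open Cygan ball of radius [k^(1/4)] centred at [o], since
    [|z1 / z3|] is the square of the Cygan norm. *)
Definition ball k z : R := k * nsq z@3 - nsq z@1.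

Lemma ball_continuous k : orbit_continuous (ball k).
Proof.
apply: orbit_continuousB; last exact: orbit_continuous_nsq.
apply: orbit_continuousM; last exact: orbit_continuous_nsq.
exact: orbit_continuous_cst.
Qed.

Lemma ball_expels s th t k :
  (forall w, 16 * k <= (w ^+ 2 + s ^+ 2) ^+ 2 + 4 * (s * w - t) ^+ 2) ->
  expels (heis_infty s th t) (ball k).
Proof.
move=> hk n z zi; rewrite /ball heis_inftyX3 subr_gt0 subr_lt0 => hz.
have h1 := ball_disjoint_image th hk zi hz.
pose u j := nsq (heis_infty s th t ^+ j *m z)@1.
have cu j : 2 * u j.+1 <= u j + u j.+2 by exact: heis_inftyX_convex.
have u0 : u 0 = nsq z@1 by rewrite /u expr0 mul1mx.
have u1 : u 1 = nsq (heis_infty s th t *m z)@1 by rewrite /u expr1.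
have u01 : u 0 <= u 1 by rewrite u0 u1 ltW // (lt_trans hz h1).
apply: (@lt_le_trans _ _ (u 1)); first by rewrite u1.
exact: convex_seq_nondecreasing.
Qed.

(** The inversion maps the exterior of the ball of parameter [k] to the ball of parameter [k^-1],
    which is the one that [B] must expel. *)
Lemma schottky_balls s1 th1 t1 s2 th2 t2 k : 0 < k ->
  (forall w, 16 * k <= (w ^+ 2 + s1 ^+ 2) ^+ 2 + 4 * (s1 * w - t1) ^+ 2) ->
  (forall w, 16 * k^-1 <= (w ^+ 2 + s2 ^+ 2) ^+ 2 + 4 * (s2 * w - t2) ^+ 2) ->
  schottky (heis_infty s1 th1 t1) (heis_o s2 th2 t2).
Proof.
move=> k0 h1 h2.
have neg s t c : (forall w, c <= (w ^+ 2 + s ^+ 2) ^+ 2 + 4 * (s * w - t) ^+ 2) ->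
    forall w, c <= (w ^+ 2 + (- s) ^+ 2) ^+ 2 + 4 * (- s * w - - t) ^+ 2.
  by move=> h w; apply: le_trans (h w) _; rewrite le_eqVlt; apply/orP; left;
    apply/eqP; ring.
exists (ball k); split.
- exact: ball_continuous.
- exists (hvec 0 0 0); first exact: hvec_isotropic.
  by rewrite [ltRHS](_ : _ = k) // /ball /nsq !mxE /=; field.
- by rewrite heis_inftyV; split; apply: ball_expels => //; exact: neg.
rewrite heis_oV; have k'0 : 0 < k^-1 by rewrite invr_gt0.
have main s t : expels (heis_infty s th2 t) (ball k^-1) ->
    expels (heis_o s th2 t) (fun z => - ball k z).
  have scale z : - ball k z = k * ball k^-1 (swap R *m z).
    by rewrite /ball swap1 swap3; field; rewrite gt_eqF.
  move=> /expels_o_swap H n z zi; rewrite !scale pmulr_rgt0 // pmulr_rlt0 //.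
  exact: H.
by split; apply: main; apply: ball_expels => //; exact: neg.
Qed.

(** Expanding the right side gives the quartic of [cygan_quartic_min]. Here [X] and [Y] are cube
    roots of [M + t] and [M - t], and [X^2 - X Y + Y^2 = 2 M / (X + Y)] gives the minimum. *)
Lemma cygan_quartic_ge (s t M a b w : R) : 0 <= s -> 0 < M -> M ^+ 2 = s ^+ 4 + t ^+ 2 ->
  0 <= a -> 0 <= b -> a ^+ 3 = 1 + t / M -> b ^+ 3 = 1 - t / M ->
  8 * M ^+ 2 / (a + b) ^+ 3 <= (w ^+ 2 + s ^+ 2) ^+ 2 + 4 * (s * w - t) ^+ 2.
Proof.
move=> s0 M0 M2 a0 b0 a3 b3; have Mn : M != 0 by rewrite gt_eqF.
have cube (x : R) : 0 <= x -> (x `^ (1 / 3)) ^+ 3 = x.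
  move=> x0; rewrite -powR_mulrn ?powR_ge0 // -powRrM.
  by rewrite (_ : 1 / 3 * 3%:R = 1) ?powRr1 //; field.
pose mu := M `^ (1 / 3); pose X := mu * a; pose Y := mu * b.
have mu0 : 0 < mu by exact: powR_gt0.
have mu3 : mu ^+ 3 = M by apply: cube; exact: ltW.
have X3 : X ^+ 3 = M + t by rewrite /X exprMn mu3 a3; field.
have Y3 : Y ^+ 3 = M - t by rewrite /Y exprMn mu3 b3; field.
have XY : (s `^ (1 / 3)) ^+ 4 = X * Y.
  have X0 : 0 <= X by rewrite mulr_ge0 // ltW.
  have Y0 : 0 <= Y by rewrite mulr_ge0 // ltW.
  apply/eqP; rewrite -(@eqrXn2 _ 3) ?exprn_ge0 ?powR_ge0 ?(mulr_ge0 X0 Y0) //; apply/eqP.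
  rewrite -exprM mulnC exprM cube // exprMn X3 Y3.
  transitivity (M ^+ 2 - t ^+ 2); last by ring.
  by rewrite M2; ring.
have tE : t = (X ^+ 3 - Y ^+ 3) / 2 by rewrite X3 Y3; field.
have := @cygan_quartic_min R w s t X Y _ (cube s s0) XY tE.
have ab0 : a + b != 0.
  rewrite paddr_eq0 //; apply/negP => /andP[/eqP ae /eqP be].
  by move: a3 b3; rewrite ae be expr0n /= => h1 h2; lra.
have -> : (X ^+ 2 - X * Y + Y ^+ 2) ^+ 3 = 8 * M ^+ 2 / (a + b) ^+ 3.
  have e : (a ^+ 2 - a * b + b ^+ 2) * (a + b) = 2.
    transitivity (a ^+ 3 + b ^+ 3); first by ring.
    by rewrite a3 b3; ring.
  rewrite (_ : X ^+ 2 - _ + _ = mu ^+ 2 * (a ^+ 2 - a * b + b ^+ 2)); last first.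
    by rewrite /X /Y; ring.
  have -> : a ^+ 2 - a * b + b ^+ 2 = 2 / (a + b) by rewrite -e mulfK.
  by rewrite exprMn -exprM mulnC exprM mu3; field.
by move/le_trans; apply; rewrite le_eqVlt; apply/orP; left; apply/eqP; ring.
Qed.

Lemma schottky_cygan (s1 th1 t1 s2 th2 t2 M1 a1 b1 M2 a2 b2 : R) :
  0 <= s1 -> 0 < M1 -> M1 ^+ 2 = s1 ^+ 4 + t1 ^+ 2 ->
  0 <= a1 -> 0 <= b1 -> a1 ^+ 3 = 1 + t1 / M1 -> b1 ^+ 3 = 1 - t1 / M1 ->
  0 <= s2 -> 0 < M2 -> M2 ^+ 2 = s2 ^+ 4 + t2 ^+ 2 ->
  0 <= a2 -> 0 <= b2 -> a2 ^+ 3 = 1 + t2 / M2 -> b2 ^+ 3 = 1 - t2 / M2 ->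
  4 * (a2 + b2) ^+ 3 * (a1 + b1) ^+ 3 <= M1 ^+ 2 * M2 ^+ 2 ->
  schottky (heis_infty s1 th1 t1) (heis_o s2 th2 t2).
Proof.
move=> s10 M10 M1E a10 b10 a13 b13 s20 M20 M2E a20 b20 a23 b23 h.
have sum_gt0 (a b x : R) : 0 <= a -> 0 <= b -> a ^+ 3 = 1 + x ->
    b ^+ 3 = 1 - x -> 0 < a + b.
  move=> a0 b0 a3 b3; rewrite lt_def addr_ge0 // andbT paddr_eq0 //.
  apply/negP => /andP[/eqP ae /eqP be].
  by move: a3 b3; rewrite ae be expr0n /= => h1 h2; lra.
have f1 := exprn_gt0 3 (sum_gt0 _ _ _ a10 b10 a13 b13).
have f2 := exprn_gt0 3 (sum_gt0 _ _ _ a20 b20 a23 b23).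
have q1 w := @cygan_quartic_ge s1 t1 M1 a1 b1 w s10 M10 M1E a10 b10 a13 b13.
have q2' w := @cygan_quartic_ge s2 t2 M2 a2 b2 w s20 M20 M2E a20 b20 a23 b23.
move: ((a1 + b1) ^+ 3) ((a2 + b2) ^+ 3) f1 f2 h q1 q2' => f1 f2 f10 f20 h q1 q2'.
have M10' := exprn_gt0 2 M10; have M20' := exprn_gt0 2 M20.
(* The largest [k] that the bound [q1] allows for [A]; the condition for [B] then becomes hypothesis
   [h]. *)
apply: (@schottky_balls _ _ _ _ _ _ (M1 ^+ 2 / (2 * f1))).
- by rewrite divr_gt0 // mulr_gt0.
- move=> w; apply: le_trans (q1 w); rewrite le_eqVlt; apply/orP; left.
  by apply/eqP; field; rewrite gt_eqF.
- move=> w; apply: le_trans (q2' w).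
  rewrite invf_div mulrA ler_pdivrMr // mulrAC ler_pdivlMr //.
  by move: h; lra.
Qed.

End CyganBalls.

(** * From fractional powers to the slab and ball criteria *)

Section Modulus.
Local Open Scope complex_scope.
Variable R : realType.
Implicit Types s t x y : R.

Lemma heis_mod_sqr s t : heis_mod s t ^+ 2 = s ^+ 4 + t ^+ 2.
Proof.
rewrite /heis_mod /= sqr_sqrtr ?addr_ge0 ?sqr_ge0 //.
by rewrite -exprM.
Qed.

Lemma heis_mod_gt0 s t : (s, t) <> (0, 0) -> 0 < heis_mod s t.
Proof.
move=> st; rewrite lt_def sqrtr_ge0 andbT; apply/eqP => M0.
have := heis_mod_sqr s t; rewrite M0 expr0n /= => /esym/eqP.
rewrite paddr_eq0 ?exprn_even_ge0 // !expf_eq0 /= => /andP[/eqP s0 /eqP t0].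
by apply: st; rewrite s0 t0.
Qed.

Lemma heis_mod_ratio s t : (s, t) <> (0, 0) -> `|t / heis_mod s t| <= 1.
Proof.
move=> /heis_mod_gt0 M0; rewrite normf_div (gtr0_norm M0) ler_pdivrMr // mul1r.
rewrite -(@ler_pXn2r _ 2) // ?nnegrE ?(ltW M0) // heis_mod_sqr.
by rewrite real_normK ?num_real // lerDr exprn_even_ge0.
Qed.

Lemma powRX x y n : (x `^ y) ^+ n = x `^ (y * n%:R).
Proof. by rewrite -powR_mulrn ?powR_ge0 // powRrM. Qed.

Lemma schottky_of_slab s1 th1 t1 s2 th2 t2 : 0 <= s2 -> (s2, t2) <> (0, 0) ->
  (s2 != 0 -> 0 <= cos (th1 - th2)) ->
  s1 * heis_mod s2 t2 `^ (1 / 2) >=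
    (if s2 != 0 then
       2 * s2 ^+ 3 / heis_mod s2 t2 `^ (3 / 2) * cos (th1 - th2) + 2
     else 2) ->
  schottky (heis_infty s1 th1 t1) (heis_o s2 th2 t2).
Proof.
move=> s20 st2 hc h.
have := heis_mod_gt0 st2; set M := heis_mod s2 t2 in h * => M0.
pose m := M `^ (1 / 2).
have m0 : 0 < m by exact: powR_gt0.
have m3 : M `^ (3 / 2) = m ^+ 3 by rewrite powRX; congr powR; field.
have m4 : m ^+ 4 = M ^+ 2.
  rewrite powRX -powR_mulrn; last exact: ltW.
  by congr powR; field.
have mn : m != 0 by rewrite gt_eqF.
apply: (@schottky_slab_ball _ _ _ _ _ _ _ m) => //; first by rewrite m4 heis_mod_sqr.
rewrite -/m m3 in h.
(* At [s2 = 0] the cubic term vanishes, so both branches take the same form. *)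
have {}h : 2 * (s2 ^+ 3 * cos (th1 - th2)) / m ^+ 3 + 2 <= s1 * m /\
    0 <= s2 ^+ 3 * cos (th1 - th2).
  move: h hc; have [-> h _|_ h /(_ isT) c0] := eqVneq s2 0.
    by rewrite expr0n /= !(mul0r, mulr0) add0r.
  split; last by rewrite mulr_ge0 ?exprn_ge0.
  by apply: le_trans h; rewrite le_eqVlt; apply/orP; left; apply/eqP; ring.
case: h => h c0; rewrite ger0_norm //.
move: c0 h; set e := s2 ^+ 3 * _ => c0 h.
have -> : e / m ^+ 4 + m^-1 = (2 * e / m ^+ 3 + 2) / (2 * m) by field.
by rewrite ler_pdivrMr ?mulr_gt0 //; apply: le_trans h _; rewrite le_eqVlt;
  apply/orP; left; apply/eqP; field.
Qed.

Lemma le_pow4 x1 x2 y1 y2 : 0 <= x1 -> 0 <= x2 -> 0 <= y1 -> 0 <= y2 ->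
  2 `^ (1 / 2) * y2 `^ (3 / 4) * y1 `^ (3 / 4) <= x1 `^ (1 / 2) * x2 `^ (1 / 2) ->
  4 * y2 ^+ 3 * y1 ^+ 3 <= x1 ^+ 2 * x2 ^+ 2.
Proof.
move=> x10 x20 y10 y20 h.
have e2 x : 0 <= x -> (x `^ (1 / 2)) ^+ 4 = x ^+ 2.
  by move=> x0; rewrite powRX -powR_mulrn //; congr powR; field.
have e3 x : 0 <= x -> (x `^ (3 / 4)) ^+ 4 = x ^+ 3.
  by move=> x0; rewrite powRX -powR_mulrn //; congr powR; field.
have -> : 4 * y2 ^+ 3 * y1 ^+ 3 =
    (2 `^ (1 / 2) * y2 `^ (3 / 4) * y1 `^ (3 / 4)) ^+ 4.
  rewrite 2!exprMn (e3 y2) // (e3 y1) // (e2 2) //; ring.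
have -> : x1 ^+ 2 * x2 ^+ 2 = (x1 `^ (1 / 2) * x2 `^ (1 / 2)) ^+ 4.
  by rewrite exprMn (e2 x1) // (e2 x2).
by rewrite lerXn2r // nnegrE !mulr_ge0 ?powR_ge0.
Qed.

Lemma schottky_of_balls s1 th1 t1 s2 th2 t2 : 0 <= s1 -> 0 <= s2 ->
  (s1, t1) <> (0, 0) -> (s2, t2) <> (0, 0) ->
  heis_mod s1 t1 `^ (1 / 2) * heis_mod s2 t2 `^ (1 / 2) >=
    2 `^ (1 / 2)
    * ((1 - t2 / heis_mod s2 t2) `^ (1 / 3)
       + (1 + t2 / heis_mod s2 t2) `^ (1 / 3)) `^ (3 / 4)
    * ((1 - t1 / heis_mod s1 t1) `^ (1 / 3)
       + (1 + t1 / heis_mod s1 t1) `^ (1 / 3)) `^ (3 / 4) ->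
  schottky (heis_infty s1 th1 t1) (heis_o s2 th2 t2).
Proof.
move=> s10 s20 st1 st2 h.
have cube x : 0 <= x -> (x `^ (1 / 3)) ^+ 3 = x.
  by move=> x0; rewrite powRX (_ : _ * _ = 1) ?powRr1 //; field.
(* The ratios lie in [-1, 1], so the powers of exponent 1/3 are taken of nonnegative numbers and are
   genuine cube roots. *)
have := heis_mod_ratio st1; have := heis_mod_ratio st2; rewrite !ler_norml.
move=> /andP[r2 r2'] /andP[r1 r1'].
have M10 := heis_mod_gt0 st1; have M20 := heis_mod_gt0 st2.
move: h; set b2 := (1 - t2 / _) `^ _; set a2 := (1 + t2 / _) `^ _.
set b1 := (1 - t1 / _) `^ _; set a1 := (1 + t1 / _) `^ _.
rewrite [b2 + a2]addrC [b1 + a1]addrC.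
have a10 : 0 <= a1 by exact: powR_ge0.
have a20 : 0 <= a2 by exact: powR_ge0.
have b10 : 0 <= b1 by exact: powR_ge0.
have b20 : 0 <= b2 by exact: powR_ge0.
have a13 : a1 ^+ 3 = 1 + t1 / heis_mod s1 t1 by apply: cube; lra.
have a23 : a2 ^+ 3 = 1 + t2 / heis_mod s2 t2 by apply: cube; lra.
have b13 : b1 ^+ 3 = 1 - t1 / heis_mod s1 t1 by apply: cube; lra.
have b23 : b2 ^+ 3 = 1 - t2 / heis_mod s2 t2 by apply: cube; lra.
move=> h; apply: (@schottky_cygan _ s1 th1 t1 s2 th2 t2 _ a1 b1 _ a2 b2
  s10 M10 _ _ _ a13 b13 s20 M20 _ _ _ a23 b23) => //; try exact: heis_mod_sqr.
by apply: le_pow4 h; rewrite ?addr_ge0 // ltW.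
Qed.

End Modulus.

(** * Discreteness and freeness under the four conditions *)

Unset Implicit Arguments.

Theorem theorem1p2 (R : realType) (s1 theta1 t1 s2 theta2 t2 : R)
  (hs1 : 0 <= s1) (hs2 : 0 <= s2)
  (hnt1 : (s1, t1) <> (0, 0)) (hnt2 : (s2, t2) <> (0, 0))
  (htheta : s1 != 0 -> s2 != 0 -> - (pi / 2) <= theta1 - theta2 <= pi / 2)
  (hcond :
    [\/ (* (1) *)
        heis_mod s1 t1 `^ (1 / 2) * heis_mod s2 t2 `^ (1 / 2) >=
        2 `^ (1 / 2)
        * ((1 - t2 / heis_mod s2 t2) `^ (1 / 3)
           + (1 + t2 / heis_mod s2 t2) `^ (1 / 3)) `^ (3 / 4)
        * ((1 - t1 / heis_mod s1 t1) `^ (1 / 3)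
           + (1 + t1 / heis_mod s1 t1) `^ (1 / 3)) `^ (3 / 4),
        (* (2) *)
        s1 != 0 /\
        s1 * heis_mod s2 t2 `^ (1 / 2) >=
        (if s2 != 0 then
           2 * s2 ^+ 3 / heis_mod s2 t2 `^ (3 / 2) * cos (theta1 - theta2) + 2
         else 2),
        (* (3) *)
        s2 != 0 /\
        heis_mod s1 t1 `^ (1 / 2) * s2 >=
        (if s1 != 0 then
           2 * s1 ^+ 3 / heis_mod s1 t1 `^ (3 / 2) * cos (theta1 - theta2) + 2
         else 2)
      | (* (4) *)
        [/\ s1 != 0, s2 != 0 &
            s1 * s2 >= 4 * cos ((theta1 - theta2) / 3) ^+ 3]]) :
  let A := heis_infty s1 theta1 t1 in
  let B := heis_o s2 theta2 t2 in
  is_discrete (generated [set A; B]) /\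
  freely_generates A B.
Proof.
move=> A B; apply: schottky_free_discrete.
- exact: heis_infty_SU21.
- exact: heis_o_SU21.
have hcos : s1 != 0 -> s2 != 0 -> 0 <= cos (theta1 - theta2).
  by move=> s1n s2n; apply/cos_ge0_pihalf/htheta.
case: hcond => [h|[s1n h]|[s2n h]|[s1n s2n h]].
- exact: schottky_of_balls.
- by apply: schottky_of_slab => //; exact: hcos.
(* Exchanging the generators negates the angle difference, and cosine is even. *)
- apply/schottky_swap/schottky_of_slab => //.
    by move=> s1n; rewrite -cosN opprB; exact: hcos.
  by rewrite -cosN opprB [s2 * _]mulrC.
- by apply: schottky_slab_slab => //; rewrite ?lt_def ?s1n ?s2n //; exact: htheta.
Qed.
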